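(* Let $X$ be a compact metrizable space, and suppose $O_X$ is dense in $X$. Let $C=C_X$. In each of the following cases $\tau_{k|C}\ne\tau_k$, and the compact-open topology $\tau_k$ on $H(X)$ is not minimal: (a) $C$ contains at least two points which are the limit of clopen circles, that is, $|\overline{S_X}\cap C|\ge 2$; or (b) there is a component $I$ of $I_X$ whose closure meets $C$ in at least three points, that is, $|\overline{I}\cap C|\ge 3$.
   Context: $H(X)$ denotes the group of all homeomorphisms of $X$ onto itself under composition, and $\tau_k$ is the compact-open topology on $H(X)$. A topology on a group is a group topology if the group operations are continuous for it. A Hausdorff group topology on a group is minimal if no strictly coarser group topology on the group is Hausdorff. $O_X=\{x\in X: x \text{ has a neighborhood homeomorphic to } (0,1)\}$; $C_X=X\setminus O_X$; $S_X$ is the set of all points of $X$ with a clopen neighborhood homeomorphic to the circle $S^1$; $I_X=O_X\setminus S_X$. (The components of $I_X$ are copies of $(0,1)$.) For a closed set $C\subseteq X$, a compatible metric $d$ on $X$ and $\epsilon>0$, let $C_\epsilon=\{x\in X: d(x,C)<\epsilon\}$ (with $C_\epsilon=\emptyset$ if $C=\emptyset$), and $$B_\epsilon^{\tau_{k|C}}=\{h\in H(X): d(h(x),x)<\epsilon \text{ and } d(h^{-1}(x),x)<\epsilon \text{ for all } x\in X\setminus C_\epsilon\}.$$ $\tau_{k|C}$ is the collection of all unions of translates $gB_\epsilon^{\tau_{k|C}}$ ($g\in H(X)$, $\epsilon>0$). It does not depend on the choice of compatible metric $d$. *)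

(* Defs.v *)
From HB Require Import structures.
From mathcomp Require Import all_boot all_order all_algebra.
From mathcomp Require Import all_classical all_reals all_analysis.
Set Implicit Arguments.
Unset Strict Implicit.
Unset Printing Implicit Defensive.
Import Order.TTheory GRing.Theory Num.Theory.
Import numFieldNormedType.Exports.
Local Open Scope classical_set_scope.
Local Open Scope ring_scope.

(* The maps f and g are only relevant on A and B respectively: continuity is
   for the subspace topologies, and f @` A = B together with the first
   cancellation makes f a bijection from A onto B with inverse g. *)
Definition homeomorphic (T U : topologicalType) (A : set T) (B : set U) : Prop :=
  exists (f : T -> U) (g : U -> T),
    [/\ f @` A = B, {in A, cancel f g},
        {within A, continuous f} & {within B, continuous g}].

Definition is_component (T : topologicalType) (A K : set T) : Prop :=
  exists2 x, A x & K = connected_component A x.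

Definition unit_circle (R : realType) : set (R * R) :=
  [set p | p.1 ^+ 2 + p.2 ^+ 2 = 1].
Arguments unit_circle R _ : clear implicits.

Record homeo (X : topologicalType) := Homeo {
  homeo_fun :> X -> X ;
  homeo_inv : X -> X ;
  homeo_funK : cancel homeo_fun homeo_inv ;
  homeo_invK : cancel homeo_inv homeo_fun ;
  homeo_fun_continuous : continuous homeo_fun ;
  homeo_inv_continuous : continuous homeo_inv }.

Section homeo_group.
Variable X : topologicalType.
Implicit Types f g h : homeo X.

Lemma homeo_eqP f g : (f : X -> X) = g -> f = g.
Proof.
case: f g => [f f' fK f'K cf cf'] [g g' gK g'K cg cg'] /= fg.
move: fK f'K cf cf'; rewrite fg => fK f'K cf cf'.
have f'g' : f' = g' by apply/funext => x; rewrite -[x in RHS]f'K gK.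
move: fK f'K cf cf'; rewrite f'g' => fK f'K cf cf'.
by congr Homeo; exact: Prop_irrelevance.
Qed.

HB.instance Definition _ := gen_eqMixin (homeo X).
HB.instance Definition _ := gen_choiceMixin (homeo X).

Fact homeo_id_continuous : continuous (@id X).
Proof. by move=> x; exact: cvg_id. Qed.

Definition homeo_id : homeo X :=
  @Homeo X id id (fun=> erefl) (fun=> erefl)
    homeo_id_continuous homeo_id_continuous.

Fact homeo_comp_continuous f g : continuous (f \o g).
Proof. by move=> x; apply: continuous_comp; exact: homeo_fun_continuous. Qed.

Fact homeo_comp_inv_continuous f g : continuous (homeo_inv g \o homeo_inv f).
Proof. by move=> x; apply: continuous_comp; exact: homeo_inv_continuous. Qed.

Definition homeo_comp f g : homeo X :=
  @Homeo X (f \o g) (homeo_inv g \o homeo_inv f)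
    (can_comp (homeo_funK f) (homeo_funK g))
    (can_comp (homeo_invK g) (homeo_invK f))
    (@homeo_comp_continuous f g) (@homeo_comp_inv_continuous f g).

Definition homeo_sym f : homeo X :=
  @Homeo X (homeo_inv f) f (homeo_invK f) (homeo_funK f)
    (@homeo_inv_continuous X f) (@homeo_fun_continuous X f).

Fact homeo_compA : associative homeo_comp.
Proof. by move=> f g h; exact: homeo_eqP. Qed.

Fact homeo_comp1l : left_id homeo_id homeo_comp.
Proof. by move=> f; exact: homeo_eqP. Qed.

Fact homeo_comp1r : right_id homeo_id homeo_comp.
Proof. by move=> f; exact: homeo_eqP. Qed.

Fact homeo_compVl : left_inverse homeo_id homeo_sym homeo_comp.
Proof. by move=> f; apply/homeo_eqP/funext => x /=; exact: homeo_funK. Qed.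

Fact homeo_compVr : right_inverse homeo_id homeo_sym homeo_comp.
Proof. by move=> f; apply/homeo_eqP/funext => x /=; exact: homeo_invK. Qed.

HB.instance Definition _ := isGroup.Build (homeo X)
  homeo_compA homeo_comp1l homeo_comp1r homeo_compVl homeo_compVr.

End homeo_group.

(* A topology is given by its family of open sets, so that several topologies
   on the same group can be compared by inclusion. *)
Definition is_topology (T : Type) (O : set (set T)) : Prop :=
  [/\ O setT,
      forall A B, O A -> O B -> O (A `&` B) &
      forall F : set (set T), F `<=` O -> O (\bigcup_(A in F) A)].

Definition hausdorff_topology (T : Type) (O : set (set T)) : Prop :=
  forall x y, x <> y ->
    exists U V, [/\ O U, O V, U x, V y & U `&` V = set0].

(* Joint continuity of the product is written with basic open boxes of the
   product topology. *)
Definition is_group_topology (G : groupType) (O : set (set G)) : Prop :=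
  [/\ is_topology O,
      forall (g h : G) (W : set G), O W -> W (g * h)%g ->
        exists U V, [/\ O U, O V, U g, V h &
          forall a b, U a -> V b -> W (a * b)%g] &
      forall W : set G, O W -> O [set g | W (g^-1)%g]].

(* Meaningful for O a Hausdorff group topology; this is not made part of the
   definition, so that the negation always provides a strictly coarser
   Hausdorff group topology. *)
Definition minimal_group_topology (G : groupType) (O : set (set G)) : Prop :=
  ~ exists O' : set (set G),
      [/\ is_group_topology O', hausdorff_topology O' & O' `<` O].

(* The trace on the group of homeomorphisms of the compact-open topology on
   the space of all functions. *)
Definition tau_k (X : topologicalType) : set (set (homeo X)) :=
  [set U | exists2 W : set {compact-open, X -> X},
     open W & U = [set h | W (homeo_fun h)]].
Arguments tau_k X _ : clear implicits.

Section metric_space.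
Context {R : realType} (X : metricType R).

Definition O_ : set X :=
  [set x | exists2 U, nbhs x U & homeomorphic U (`]0, 1[ : set R)].

Definition C_ : set X := ~` O_.

Definition S_ : set X :=
  [set x | exists U, [/\ clopen U, U x & homeomorphic U (unit_circle R)]].

Definition I_ : set X := O_ `\` S_.

(* The infimum is taken in the extended reals, so the distance to the empty
   set is +oo and the thickening of the empty set is empty. *)
Definition thickening (C : set X) (e : R) : set X :=
  [set x | (ereal_inf [set (mdist x c)%:E | c in C] < e%:E)%E].

Definition B_tau_kC (C : set X) (e : R) : set (homeo X) :=
  [set h : homeo X | forall x, ~ thickening C e x ->
     mdist (h x) x < e /\ mdist ((h^-1)%g x) x < e].

Definition tau_kC (C : set X) : set (set (homeo X)) :=
  [set U | exists2 F : set (set (homeo X)),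
     (forall A, F A -> exists (g : homeo X) (e : R),
        0 < e /\ A = [set (g * b)%g | b in B_tau_kC C e]) &
     U = \bigcup_(A in F) A].

End metric_space.

Arguments O_ {R} X _.
Arguments C_ {R} X _.
Arguments S_ {R} X _.
Arguments I_ {R} X _.

(* Main.v *)
Require Import Defs.
From HB Require Import structures.
From mathcomp Require Import all_boot all_order all_algebra.
From mathcomp Require Import all_classical all_reals all_analysis.
From mathcomp Require Import ring lra.
Set Implicit Arguments.
Unset Strict Implicit.
Unset Printing Implicit Defensive.
Import Order.TTheory GRing.Theory Num.Theory.
Import numFieldNormedType.Exports.
Local Open Scope classical_set_scope.
Local Open Scope card_scope.
Local Open Scope ring_scope.

(** Write C for the complement of the one-dimensional part O of X. Any
    homeomorphism maps C onto itself, and X is compact; this makes the sets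
    B_tau_kC C e behave like the basic neighborhoods of the identity of a group
    topology: they are stable, up to shrinking e, under products, inverses and
    conjugation. A homeomorphism lying in all of them is the identity on the
    dense set O, so the topology tau_kC C is Hausdorff. It is coarser than tau_k,
    which on a compact metric space is the topology of uniform convergence.
    Hence everything amounts to showing that it is strictly coarser
    ([tau_kC_neq]): for some eta > 0 and every e > 0, some homeomorphism in
    B_tau_kC C e displaces some point by at least eta.

    Such homeomorphisms come from the homogeneity of connected one-dimensional
    sets ([open_connected_homogeneous]): if V is open, connected and contained
    in O, any point of V is moved to any other one by a homeomorphism of X which
    is the identity off V. If V also lies in the e-thickening of C, this
    homeomorphism is in B_tau_kC C e. It remains to find V, or a substitute for
    it, that comes close to two different points of C.

    In case (a), compactness shows that only circles close to C accumulate at C: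
    near a limit point of clopen circles there are circles contained in the
    thickening ([circle_near]). Take one circle near each of two limit points;
    either they are equal, or exchanging them and then moving a point inside the
    second one does what is needed ([two_circle_limits]).

    In case (b), the component I is a copy of the line, and two of the three
    limit points must be limits of the same end of I. The proof replaces the
    parametrization of I by a count of boundary points. Call a compact set
    [two_ended] if it has at most two boundary points and if each of its points
    belongs to a nondegenerate connected subset of it. Gluing an arc onto such a
    set moves its boundary points without creating new ones
    ([two_ended_half_arc]), so every compact subset of I is contained in a
    two-ended set M contained in I ([two_ended_exhaust]). Each component of the
    complement of M in I reaches a boundary point of M, and different components
    reach different ones, so there are at most two components
    ([pair_in_component]). When M contains the points of I that are far from C,
    these components lie in the thickening of C, and one of them comes close to
    two of the three limit points ([three_end_limits]). *)


(** * The topology relative to a closed invariant set *)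

Section compact_metric.
Context {R : realType} {X : metricType R}.
Hypothesis compactX : compact [set: X].
Implicit Types (C : set X) (e d : R) (g h k b : homeo X).

Lemma thickeningP C e x :
  thickening C e x <-> exists2 c, C c & mdist x c < e.
Proof.
split=> [/ereal_inf_lt[_ [c Cc <-]]|[c Cc xc]].
  by rewrite lte_fin => xc; exists c.
rewrite /thickening/=; apply: (@le_lt_trans _ _ (mdist x c)%:E).
  by apply: ereal_inf_lbound; exists c.
by rewrite lte_fin.
Qed.

Lemma thickening_le C d e : d <= e -> thickening C d `<=` thickening C e.
Proof.
move=> de x /thickeningP[c Cc xc]; apply/thickeningP; exists c => //.
exact: lt_le_trans xc de.
Qed.

Lemma mdist_near (x : X) e : 0 < e -> \forall y \near x, mdist x y < e.
Proof.
by move=> e0; have := nbhsx_ballx x _ e0; rewrite ballEmdist.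
Qed.

Lemma homeo_mdist_near h (x : X) e : 0 < e ->
  \forall y \near x, mdist (h x) (h y) < e.
Proof.
by move=> e0; exact: (@homeo_fun_continuous _ h x _ (mdist_near (h x) e0)).
Qed.

Lemma nbhs_mdistP (x : X) (A : set X) : nbhs x A ->
  exists2 e, 0 < e & forall y, mdist x y < e -> A y.
Proof.
move=> /nbhs_ballP[e /= e0 xA]; exists e => // y xy; apply: xA.
by rewrite ballEmdist.
Qed.

(** Uniform continuity, in the form of a single modulus for all points: a common
    modulus near each point, and compactness to make it global. *)
Lemma compact_unif_continuous (f : X -> X) e : continuous f -> 0 < e ->
  exists2 d, 0 < d & forall x y, mdist x y < d -> mdist (f x) (f y) < e.
Proof.
move=> cf e0; have e20 : 0 < e / 2 by rewrite divr_gt0.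
have : \forall d \near 0^'+, [set: X] `<=` (fun x => forall y,
  mdist x y < d -> mdist (f x) (f y) < e).
  move/compact_near_coveringP: compactX; apply => x _.
  have /nbhs_mdistP[d d0 xd] := cf x _ (mdist_near (f x) e20).
  have d20 : 0 < d / 2 by rewrite divr_gt0.
  exists ([set y | mdist x y < d / 2], [set t | t < d / 2]) => /=.
    split; first exact: mdist_near.
    exact: nbhs_right_lt.
  move=> [y t]/= [xy td] z yz.
  have fxy : mdist (f x) (f y) < e / 2 by apply: xd; lra.
  have fxz : mdist (f x) (f z) < e / 2.
    by apply: xd; have := metric_triangle x y z; lra.
  have := metric_triangle (f y) (f x) (f z).
  by rewrite (metric_sym (f y) (f x)); lra.
move=> H; near (0:R)^'+ => d; exists d; first by near: d; exact: nbhs_right_gt.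
move=> x y; move: x I y; near: d; exact: H.
Unshelve. all: by end_near. Qed.

Section group_basis.
Variable C : set X.
Local Notation B := (B_tau_kC C).

Lemma B_tau_kC1 e : 0 < e -> B e 1%g.
Proof. by move=> e0 x _; rewrite /= mdistxx. Qed.

Lemma B_tau_kC_le d e : d <= e -> B d `<=` B e.
Proof.
move=> de b Bb x xe; have [] := Bb x.
  by move=> xd; apply: xe; exact: thickening_le xd.
by move=> hx hVx; split; apply: lt_le_trans de.
Qed.

Lemma B_tau_kCV e b : B e b -> B e (b^-1)%g.
Proof. by move=> Bb x xe; have [? ?] := Bb x xe; split => //;
  rewrite invgK. Qed.

(** A point outside the e-thickening is moved by less than e / 2, so it stays
    outside the (e / 2)-thickening, where the second factor is controlled. *)
Lemma B_tau_kCM e b k : 0 < e -> B (e / 2) b -> B (e / 2) k -> B e (b * k)%g.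
Proof.
move=> e0; have sub b' k' x : ~ thickening C e x -> B (e / 2) b' ->
    B (e / 2) k' -> mdist (b' (k' x)) x < e.
  move=> xe Bb Bk; have [|kx _] := Bk x.
    by move=> xe2; apply: xe; apply: thickening_le xe2; lra.
  have [|+ _] := Bb (k' x).
    move=> /thickeningP[c Cc kxc]; apply: xe; apply/thickeningP; exists c => //.
    have := metric_triangle x (k' x) c; rewrite (metric_sym x (k' x)); lra.
  by have := metric_triangle (b' (k' x)) (k' x) x; lra.
move=> Bb Bk x xe; split; first exact: sub.
by rewrite invgM; apply: sub => //; exact: B_tau_kCV.
Qed.

Hypothesis homeoC : forall (g : homeo X) c, C c -> C (g c).

(** A homeomorphism preserving C carries points close to C to points close
    to C, by uniform continuity. *)
Lemma thickening_homeo g e : 0 < e ->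
  exists2 d, 0 < d & forall x, thickening C d x -> thickening C e (g x).
Proof.
move=> e0; have [d d0 gd] :=
  compact_unif_continuous (@homeo_fun_continuous _ g) e0.
exists d => // x /thickeningP[c Cc xc]; apply/thickeningP; exists (g c);
  first exact: homeoC.
exact: gd.
Qed.

Lemma B_tau_kCJ g e : 0 < e ->
  exists2 d, 0 < d & forall b, B d b -> B e (g * b * g^-1)%g.
Proof.
move=> e0; have [d1 d10 gd1] := thickening_homeo g e0.
have [d2 d20 gd2] := compact_unif_continuous (@homeo_fun_continuous _ g) e0.
have d0 : 0 < Num.min d1 d2 by rewrite lt_min d10.
exists (Num.min d1 d2) => // b Bb.
have sub k : B (Num.min d1 d2) k -> forall x, ~ thickening C e x ->
    mdist (g (k (g^-1%g x))) x < e.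
  move=> Bk x xe; rewrite -{2}(homeo_invK g x); apply: gd2.
  have [|+ _] := Bk (g^-1%g x).
    move=> gxd; apply: xe; rewrite -(homeo_invK g x); apply: gd1.
    by apply: thickening_le gxd; rewrite ge_min lexx.
  by rewrite lt_min => /andP[].
move=> x xe; split; first exact: sub.
by rewrite !invgM invgK mulgA; apply: sub => //; exact: B_tau_kCV.
Qed.

Lemma thickeningC_compact e : compact (~` thickening C e).
Proof.
apply: subclosed_compact compactX _ => //; apply: open_closedC.
rewrite openE => x /thickeningP[c Cc xc].
have xc0 : 0 < e - mdist x c by lra.
apply: filterS (mdist_near x xc0) => y xy; apply/thickeningP; exists c => //.
by have := metric_triangle y x c; rewrite (metric_sym y x); lra.
Qed.

(** The strict inequalities defining B e leave, by compactness of the complement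
    of the thickening, a uniform slack for b and for its inverse. This makes
    every coset of B e a neighborhood of each of its points. *)
Lemma B_tau_kC_open e b : 0 < e -> B e b ->
  exists2 d, 0 < d & forall k, B d k -> B e (b * k)%g.
Proof.
move=> e0 Bb.
have Bslack k : B e k -> exists2 d, 0 < d & forall x, ~ thickening C e x ->
    mdist (k x) x + d <= e.
  move=> Bk.
  have : \forall d \near 0^'+, ~` thickening C e `<=` (fun x =>
    (mdist (k x) x + d <= e)%R).
    move/compact_near_coveringP: (@thickeningC_compact e); apply => x xe.
    have [kx _] := Bk x xe.
    have s0 : 0 < (e - mdist (k x) x) / 3 by rewrite divr_gt0// subr_gt0.
    exists ([set y | mdist x y < (e - mdist (k x) x) / 3 /\
       mdist (k x) (k y) < (e - mdist (k x) x) / 3],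
       [set t | t < (e - mdist (k x) x) / 3]) => /=.
      split; last exact: nbhs_right_lt.
      apply: filterI; first exact: mdist_near.
      exact: (homeo_mdist_near k x s0).
    move=> [y t]/= [[xy kxy] td].
    have := metric_triangle (k y) (k x) y; have := metric_triangle (k x) x y.
    by rewrite (metric_sym (k y) (k x)); lra.
  move=> H; near (0:R)^'+ => d; exists d; first by near: d;
    exact: nbhs_right_gt.
  near: d; exact: H.
have [d1 d10 Hd1] := Bslack b Bb.
have [d2 d20 Hd2] := Bslack _ (B_tau_kCV Bb).
have [d3 d30 Hd3] := compact_unif_continuous (@homeo_fun_continuous _ b) d10.
have [d4 d40 Hd4] := thickening_homeo b e0.
exists (Num.min (Num.min e d2) (Num.min d3 d4)).
  by rewrite !lt_min e0 d20 d30.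
set d := Num.min _ _ => k Bk.
have [de dd2 dd3 dd4] : [/\ d <= e, d <= d2, d <= d3 & d <= d4].
  by rewrite /d !ge_min !lexx !orbT.
move=> x xe; split.
  have [|kx _] := Bk x.
    by move=> xd; apply: xe; exact: thickening_le xd.
  have /Hd3 : mdist (k x) x < d3 by lra.
  by have := Hd1 x xe; have := metric_triangle (b (k x)) (b x) x; rewrite /=;
    lra.
have [|_] := Bk (b^-1%g x).
  move=> xd; apply: xe; rewrite -(homeo_invK b x).
  by apply: Hd4; exact: thickening_le xd.
rewrite invgM.
have := Hd2 x xe; have := metric_triangle (k^-1%g (b^-1%g x)) (b^-1%g x) x.
by rewrite /=; lra.
Unshelve. all: by end_near. Qed.

(** The usual description of the open sets of a group topology by a basis of
    neighborhoods of the identity; all later facts on tau_kC go through it. *)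
Lemma tau_kCP U : tau_kC C U <->
  forall h, U h -> exists2 e, 0 < e & forall b, B e b -> U (h * b)%g.
Proof.
split=> [[F HF ->] h [A FA]|HU].
  have [g [e [e0 EA]]] := HF A FA; rewrite EA => -[b Bb <-].
  have [d d0 Hd] := B_tau_kC_open e0 Bb; exists d => // k Bk.
  by exists A => //; rewrite EA; exists (b * k)%g; [exact: Hd|rewrite mulgA].
exists [set A | exists g e, [/\ 0 < e, A = [set (g * b)%g | b in B e] & A `<=`
  U]].
  by move=> A [g [e [e0 -> _]]]; exists g, e.
apply/seteqP; split=> [h Uh|h [A [g [e [_ _ AU]]]]]; last exact: AU.
have [e e0 He] := HU h Uh.
exists [set (h * b)%g | b in B e].
  by exists h, e; split => // _ [b Bb <-]; exact: He.
by exists 1%g; [exact: B_tau_kC1|rewrite mulg1].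
Qed.

Lemma tau_kC_coset g e : 0 < e -> tau_kC C [set (g * b)%g | b in B e].
Proof.
move=> e0; exists [set [set (g * b)%g | b in B e]]; last by rewrite bigcup_set1.
by move=> _ ->; exists g, e.
Qed.

Lemma tau_kC_group_topology : is_group_topology (tau_kC C).
Proof.
split.
- split.
  + by apply/tau_kCP => h _; exists 1.
  + move=> U V /tau_kCP HU /tau_kCP HV; apply/tau_kCP => h [Uh Vh].
    have [e e0 He] := HU h Uh; have [d d0 Hd] := HV h Vh.
    exists (Num.min e d); first by rewrite lt_min e0.
    move=> b Bb; split; [apply: He|apply: Hd]; apply: B_tau_kC_le Bb;
      by rewrite ge_min lexx ?orbT.
  + move=> F FO; apply/tau_kCP => h [A FA Ah].
    have /tau_kCP/(_ h Ah)[e e0 He] := FO A FA; exists e => // b Bb.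
    by exists A => //; exact: He.
- move=> g h W /tau_kCP HW Wgh; have [e e0 He] := HW _ Wgh.
  have e20 : 0 < e / 2 by rewrite divr_gt0.
  have [d d0 Hd] := B_tau_kCJ h^-1%g e20.
  exists [set (g * b)%g | b in B d], [set (h * b)%g | b in B (e / 2)]; split.
  + exact: tau_kC_coset.
  + exact: tau_kC_coset.
  + by exists 1%g; [exact: B_tau_kC1|rewrite mulg1].
  + by exists 1%g; [exact: B_tau_kC1|rewrite mulg1].
  + move=> _ _ [b Bb <-] [k Bk <-].
    have -> : (g * b * (h * k) = g * h * ((h^-1 * b * h^-1^-1) * k))%g.
      by rewrite invgK !mulgA mulgK.
    by apply: He; apply: B_tau_kCM => //; exact: Hd.
- move=> W /tau_kCP HW; apply/tau_kCP => h /= Wh.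
  have [e e0 He] := HW _ Wh; have [d d0 Hd] := B_tau_kCJ h e0.
  exists d => // b Bb.
  have -> : ((h * b)^-1 = h^-1 * (h * b^-1 * h^-1))%g.
    by rewrite invgM !mulgA mulVg mul1g.
  by apply: He; apply: Hd; exact: B_tau_kCV.
Qed.

Hypothesis closedC : closed C.
Hypothesis denseC : dense (~` C).

(** If g and h are not separated, then g^-1 h lies in every B e, hence fixes each
    point outside C, hence is the identity by density. *)
Lemma tau_kC_hausdorff : hausdorff_topology (tau_kC C).
Proof.
move=> g h gh.
have [e e0 He] : exists2 e, 0 < e & ~ B e (g^-1 * h)%g.
  apply: contrapT => H; apply: gh.
  have {}H e : 0 < e -> B e (g^-1 * h)%g.
    by move=> e0; apply: contrapT => He; apply: H; exists e.
  have fixC x : ~ C x -> (g^-1 * h)%g x = x.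
    move=> Cx; have /nbhs_mdistP[e e0 He] : nbhs x (~` C).
      by apply: open_nbhs_nbhs; split => //; exact: closed_openC.
    apply: mdist_positivity; apply/eqP; rewrite eq_le mdist_ge0 andbT.
    rewrite leNgt; apply/negP => d0.
    have [] := H (Num.min e (mdist ((g^-1 * h)%g x) x)) _ x.
    - by rewrite lt_min e0.
    - by move=> /thickeningP[c Cc]; rewrite lt_min => /andP[/He].
    - by rewrite lt_min ltxx andbF.
  suff ft x : (g^-1 * h)%g x = x.
    have /(congr1 (fun k => g * k)%g) : (g^-1 * h = 1)%g.
      by apply: homeo_eqP; apply/funext => x; exact: ft.
    by rewrite mulgA mulgV mul1g mulg1.
  apply: contrapT => ftx.
  pose k := (g^-1 * h)%g.
  have [U [V [+ + UV]]] : exists U V : set X, [/\ open_nbhs (k x) U,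
       open_nbhs x V & U `&` V = set0].
    have := metric_hausdorff (T := X); rewrite open_hausdorff.
    move=> /(_ (k x) x (introN eqP ftx)).
    move=> [[U V]] /= [/set_mem Ux /set_mem Vx] [oU oV UV].
    by exists U, V; split => //; apply/eqP.
  move=> [oU Uk] [oV Vx].
  have : open (V `&` k @^-1` U).
    apply: openI => //; apply: open_comp => // y _.
    exact: homeo_fun_continuous.
  move=> oW; have [|y [[Vy Uky] Cy]] := denseC _ oW; first by exists x.
  have kyy : k y = y := fixC y Cy.
  have : (U `&` V) y by split=> //; rewrite -kyy.
  by rewrite UV.
have e20 : 0 < e / 2 by rewrite divr_gt0.
exists [set (g * b)%g | b in B (e / 2)], [set (h * b)%g | b in B (e / 2)];
  split.
- exact: tau_kC_coset.
- exact: tau_kC_coset.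
- by exists 1%g; [exact: B_tau_kC1|rewrite mulg1].
- by exists 1%g; [exact: B_tau_kC1|rewrite mulg1].
- rewrite -subset0 => _ [[b Bb <-] [k Bk hkgb]]; apply: He.
  have -> : (g^-1 * h = b * k^-1)%g.
    by apply: (mulgI g); apply: (mulIg k);
      rewrite -!mulgA mulVg mulg1 !mulgA mulgV mul1g.
  by apply: B_tau_kCM => //; exact: B_tau_kCV.
Qed.

End group_basis.

(** On a compact metric space the compact-open topology is that of uniform
    convergence. From compact-open to uniform: the image of a compact K in an
    open O stays in O under small displacements. Conversely, near x the sets
    K = {y | d(h x, h y) <= e / 4} and O = ball(h x, e / 2) control the
    displacement, and finitely many such K cover. *)
Lemma tau_kP U : tau_k X U <->
  forall h, U h -> exists2 e, 0 < e &
    forall k, (forall x, mdist (h x) (k x) < e) -> U k.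
Proof.
split=> [[W oW ->] h Wh|HU].
  pose F : set_system (X -> X) := filter_from [set e : R | 0 < e]
    (fun e => [set u : X -> X | forall x, mdist (h x) (u x) < e]).
  have FF : Filter F.
    apply: filter_from_filter; first by exists 1 => /=.
    move=> e d e0 d0; exists (Num.min e d); first by rewrite /= lt_min e0.
    by move=> u /= hu; split => x; have := hu x; rewrite lt_min => /andP[].
  have : F --> (homeo_fun h : {compact-open, X -> X}).
    apply/compact_open_cvgP => K O cK oO hKO.
    have : \forall e \near 0^'+, K `<=` (fun x => forall y,
      mdist (h x) y < e -> O y).
      move/compact_near_coveringP: cK; apply => x Kx.
      have /nbhs_mdistP[e e0 He] : nbhs (h x) O.
        by apply: open_nbhs_nbhs; split => //; apply: hKO; exists x.
      have e20 : 0 < e / 2 by rewrite divr_gt0.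
      exists ([set y | mdist (h x) (h y) < e / 2], [set t | t < e / 2]) => /=.
        split; last exact: nbhs_right_lt.
        exact: (homeo_mdist_near h x e20).
      move=> [y t]/= [hxy te] z hyz; apply: He.
      by have := metric_triangle (h x) (h y) z; lra.
    move=> H; near (0:R)^'+ => e; exists e; first by near: e;
      exact: nbhs_right_gt.
    move=> u hu _ [x Kx <-].
    suff KO' : K `<=` (fun x => forall y,
      mdist (h x) y < e -> O y) by exact: KO' (hu x).
    by near: e; exact: H.
  move=> /(_ W)[]; first exact: open_nbhs_nbhs.
  by move=> e e0 HW; exists e => // k hk; exact: HW.
pose E := [set u : {compact-open, X -> X} | forall k : homeo X,
  homeo_fun k = u -> U k].
exists E°; first exact: open_interior.
apply/seteqP; split=> h; last by move=> /interior_subset /(_ h erefl).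
move=> Uh; have [e e0 He] := HU h Uh.
suff : \forall u \near (homeo_fun h : {compact-open, X -> X}),
    [set: X] `<=` (fun x => mdist (h x) (u x) < e).
  by rewrite /interior/=; apply: filterS => u /= hu k ku; apply: He => x;
    rewrite ku; exact: hu.
have /compact_near_coveringP cov := compactX.
pose F : set_system {compact-open, X -> X} :=
  nbhs (homeo_fun h : {compact-open, X -> X}).
have FF : Filter F by exact: nbhs_filter.
apply: (cov _ F) => x _.
have e40 : 0 < e / 4 by rewrite divr_gt0.
have e20 : 0 < e / 2 by rewrite divr_gt0.
pose K := [set y | mdist (h x) (h y) <= e / 4].
have cK : compact K.
  apply: subclosed_compact compactX _ => //.
  have -> : K = ~` [set y | e / 4 < mdist (h x) (h y)].
    apply/seteqP; split=> y /=; first by move=> ?; apply/negP; rewrite -leNgt.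
    by move/negP; rewrite -leNgt.
  apply: open_closedC; rewrite openE => y /= xy.
  have s0 : 0 < mdist (h x) (h y) - e / 4 by rewrite subr_gt0.
  apply: filterS (homeo_mdist_near h y s0) => z /= yz.
  have := metric_triangle (h x) (h z) (h y); rewrite (metric_sym (h z)); lra.
pose O := [set y | mdist (h x) y < e / 2].
exists (K, [set u : {compact-open, X -> X} | u @` K `<=` O]) => /=.
  split.
    apply: filterS (homeo_mdist_near h x e40) => y /=.
    exact: ltW.
  apply: open_nbhs_nbhs; split.
    apply: compact_open_open => //; rewrite openE => y /= xy.
    have s0 : 0 < e / 2 - mdist (h x) y by rewrite subr_gt0.
    apply: filterS (mdist_near y s0) => z yz; rewrite /O/=.
    by have := metric_triangle (h x) y z; lra.
  by move=> _ [y Ky <-]; rewrite /O/=; apply: le_lt_trans Ky _; lra.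
move=> [y u]/= [Ky uKO].
have : O (u y) by apply: uKO; exists y.
rewrite /O/= => uy; have := metric_triangle (h y) (h x) (u y).
by move: Ky; rewrite /K/= (metric_sym (h y) (h x)); lra.
Unshelve. all: by end_near. Qed.

Section coarser.
Variable C : set X.
Hypothesis homeoC : forall (g : homeo X) c, C c -> C (g c).

Lemma tau_kC_sub_tau_k : tau_kC C `<=` tau_k X.
Proof.
move=> U /(tau_kCP homeoC) HU; apply/tau_kP => h Uh.
have [e e0 He] := HU h Uh.
have [d d0 Hd] := compact_unif_continuous (@homeo_inv_continuous _ h) e0.
exists d => // k hk; rewrite -[k](mulVKg h); apply: He => x _; split.
  by rewrite metric_sym -{1}[x](homeo_funK h); exact: Hd.
rewrite invgM invgK /=; set z := homeo_inv k (h x).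
have /Hd : mdist (h z) (k z) < d by exact: hk.
by rewrite (homeo_funK h) /z (homeo_invK k) (homeo_funK h).
Qed.

End coarser.
End compact_metric.

(** * Open lines *)

Section open_lines.
Context {R : realType}.

(** An open embedding of the real line. Being defined on all of R spares side
    conditions on intervals; openness of the map replaces a continuous inverse
    on an open range. *)
Definition open_line (T : topologicalType) (g : R -> T) : Prop :=
  [/\ continuous g, injective g & forall V, open V -> open (g @` V)].

Lemma open_line_inv (T : topologicalType) (g : R -> T) : open_line g ->
  exists2 f : T -> R, cancel g f & forall r, {for g r, continuous f}.
Proof.
move=> [cg ig og].
have [f fK] : exists f : T -> R, forall r, f (g r) = r.
  exists (fun y => xget 0 [set r | g r = y]) => r.
  by apply: ig; case: xgetP => [_ _ //|/(_ r)]/= [].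
exists f => // r A; rewrite fK => Ar.
have : nbhs (g r) (g @` A°).
  apply: open_nbhs_nbhs; split; first by apply: og; exact: open_interior.
  by exists r => //; exact: nbhs_singleton (nbhs_interior Ar).
by apply: filterS => _ [q /interior_subset Aq <-]; rewrite /= fK.
Qed.

Lemma open_line_homeomorphic (T U : topologicalType) (g : R -> T) (h : R -> U) :
  open_line g -> open_line h -> homeomorphic (range g) (range h).
Proof.
move=> lg lh; have [cg _ _] := lg; have [ch _ _] := lh.
have [f fK cf] := open_line_inv lg; have [k kK ck] := open_line_inv lh.
exists (h \o f), (g \o k); split.
- apply/seteqP; split=> [_ [_ [r _ <-] <-]|_ [r _ <-]];
  first by exists (f (g r)).
  by exists (g r); [exists r|rewrite /= fK].
- by move=> _ /set_mem[r _ <-]; rewrite /= fK kK.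
- apply: continuous_in_subspaceT => _ /set_mem[r _ <-].
  by apply: continuous_comp; [exact: cf|exact: ch].
- apply: continuous_in_subspaceT => _ /set_mem[r _ <-].
  by apply: continuous_comp; [exact: ck|exact: cg].
Qed.

(** The rescaled map r / (1 + |r|), with inverse u / (1 - |u|), identifies R with
    a bounded open interval. *)
Lemma open_line_ball (t s : R) : 0 < s ->
  exists tau : R -> R, [/\ open_line tau, tau 0 = t & range tau = ball t s].
Proof.
move=> s0; pose sg (r : R) := t + s * (r / (1 + `|r|)).
pose vs (u : R) := ((u - t) / s) / (1 - `|(u - t) / s|).
have p1 (r : R) : 0 < 1 + `|r| by rewrite ltr_pwDl.
have sgK : cancel sg vs.
  move=> r; rewrite /vs; have -> : (sg r - t) / s = r / (1 + `|r|).
    by rewrite /sg; field; rewrite !gt_eqF.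
  rewrite normrM normfV (gtr0_norm (p1 r)).
  have -> : 1 - `|r| / (1 + `|r|) = (1 + `|r|)^-1 by field; rewrite gt_eqF.
  by rewrite invrK mulfVK// gt_eqF.
have Bsg r : ball t s (sg r).
  rewrite -ball_normE/= /sg opprD addNKr normrN normrM (gtr0_norm s0).
  rewrite gtr_pMr// normrM normfV (gtr0_norm (p1 r)) ltr_pdivrMr//.
  by rewrite mul1r ltrDr.
have vsK u : ball t s u -> sg (vs u) = u.
  rewrite -ball_normE/= distrC => ut.
  have q1 : 0 < 1 - `|(u - t) / s|.
    by rewrite subr_gt0 normrM normfV (gtr0_norm s0) ltr_pdivrMr// mul1r.
  have uE : u = t + s * ((u - t) / s) by field; rewrite gt_eqF.
  rewrite /sg /vs [RHS]uE; move: ((u - t) / s) q1 => w q1.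
  rewrite normrM normfV (gtr0_norm q1).
  have -> : 1 + `|w| / (1 - `|w|) = (1 - `|w|)^-1 by field; rewrite gt_eqF.
  by rewrite invrK mulfVK ?gt_eqF.
have csg : continuous sg.
  move=> r; apply: cvgD; first exact: cvg_cst.
  apply: cvgM; first exact: cvg_cst.
  apply: cvgM; first exact: cvg_id.
  apply: cvgV; first by rewrite gt_eqF.
  apply: cvgD; first exact: cvg_cst.
  exact: norm_continuous.
have cvs u : ball t s u -> {for u, continuous vs}.
  rewrite -ball_normE/= distrC => ut.
  have q1 : 0 < 1 - `|(u - t) / s|.
    by rewrite subr_gt0 normrM normfV (gtr0_norm s0) ltr_pdivrMr// mul1r.
  have cw : {for u, continuous (fun u : R => (u - t) / s)}.
    apply: cvgM; last exact: cvg_cst.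
    by apply: cvgB; [exact: cvg_id|exact: cvg_cst].
  apply: cvgM => //; apply: cvgV; first by rewrite gt_eqF.
  apply: cvgB; first exact: cvg_cst.
  exact: (continuous_comp cw (@norm_continuous _ _ _)).
exists sg; split.
- split => //; first exact: can_inj sgK.
  move=> V oV; rewrite openE => _ [r Vr <-].
  have vV : \forall u \near sg r, V (vs u).
    by apply: (cvs _ (Bsg r)); rewrite sgK; exact: open_nbhs_nbhs.
  have sB : \forall u \near sg r, ball t s u.
    by apply: open_nbhs_nbhs; split => //; exact: ball_open.
  near=> u; exists (vs u); first by near: u.
  by apply: vsK; near: u.
- by rewrite /sg mul0r mulr0 addr0.
- apply/seteqP; split=> [_ [r _ <-]|u Bu]; first exact: Bsg.
  by exists (vs u) => //; exact: vsK.
Unshelve. all: by end_near. Qed.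

(** The restriction of g to an interval is reparametrized by R, so that charts can
    be shrunk into any neighborhood and still be open lines. *)
Lemma sub_open_line (T : topologicalType) (g : R -> T) (t s : R) : 0 < s ->
  (forall u, ball t s u -> {for u, continuous g}) ->
  (forall u v, ball t s u -> ball t s v -> g u = g v -> u = v) ->
  (forall V, open V -> V `<=` ball t s -> open (g @` V)) ->
  exists g' : R -> T, [/\ open_line g', g' 0 = g t & range g' = g @` ball t s].
Proof.
move=> s0 cg ig og; have [tau [[ct it ot] t0 tB]] := open_line_ball t s0.
have tauB r : ball t s (tau r) by rewrite -tB; exists r.
exists (g \o tau); split; last by rewrite -tB image_comp.
- split.
  + by move=> r; apply: continuous_comp; [exact: ct|exact/cg/tauB].
  + by move=> r q /= gE; apply: it; apply: ig gE; exact: tauB.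
  + move=> V oV; rewrite -image_comp; apply: og; first exact: ot.
    by move=> _ [r _ <-]; exact: tauB.
- by rewrite /= t0.
Qed.

Lemma open_line_shift (T : topologicalType) (g : R -> T) c : open_line g ->
  open_line (fun r => g (c + r)).
Proof.
move=> [cg ig og]; split.
- move=> r; apply: (continuous_comp (g := g)); last exact: cg.
  by apply: cvgD; [exact: cvg_cst|exact: cvg_id].
- by move=> r q /ig /addrI.
- move=> V oV.
  have -> : [set g (c + r) | r in V] = g @` ((fun r => r - c) @^-1` V).
    apply/seteqP; split=> _ [r Vr <-]; last first.
      by exists (r - c) => //; rewrite addrC subrK.
    by exists (c + r) => //=; rewrite addrAC subrr add0r.
  apply: og; apply: open_comp => // r _.
  by apply: cvgB; [exact: cvg_id|exact: cvg_cst].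
Qed.

Lemma open_line_opp (T : topologicalType) (g : R -> T) : open_line g ->
  open_line (fun r => g (- r)).
Proof.
move=> [cg ig og]; split.
- move=> r; apply: (continuous_comp (g := g)); last exact: cg.
  by apply: cvgN; exact: cvg_id.
- by move=> r q /ig /oppr_inj.
- move=> V oV.
  have -> : [set g (- r) | r in V] = g @` ((fun r => - r) @^-1` V).
    apply/seteqP; split=> _ [r Vr <-]; last by exists (- r) => //;
      rewrite opprK.
    by exists (- r) => //=; rewrite opprK.
  apply: og; apply: open_comp => // r _.
  by apply: cvgN; exact: cvg_id.
Qed.

Lemma open_line_nbhs (T : topologicalType) (g : R -> T) t A : open_line g ->
  nbhs t A -> nbhs (g t) (g @` A).
Proof.
move=> [_ _ og] tA; have : nbhs (g t) (g @` A°).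
  apply: open_nbhs_nbhs; split; first by apply: og; exact: open_interior.
  by exists t => //; exact: nbhs_singleton (nbhs_interior tA).
by apply: filterS; apply: image_subset; exact: interior_subset.
Qed.

Lemma open_line_connected (T : topologicalType) (g : R -> T) (A : set R) :
  open_line g -> connected A -> connected (g @` A).
Proof.
move=> [cg _ _] cA; apply: connected_continuous_connected => //.
exact: continuous_subspaceT.
Qed.

End open_lines.

Section open_lines_metric.
Context {R : realType} {X : metricType R}.

(** The neighborhood in the definition of O need not be open: restricting its
    chart to a small interval around the image of x keeps the parametrization
    inside the interior, where it is an open map. *)
Lemma O_line (x : X) (N : set X) : O_ X x -> nbhs x N ->
  exists g : R -> X, [/\ open_line g, g 0 = x & range g `<=` N].
Proof.
move=> [U Ux [f [g [fU fgK cf cg]]]] Nx.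
have Ux' := nbhs_singleton Ux.
have gfx : g (f x) = x by apply: fgK; exact/mem_set.
have fxI : (`]0, 1[%classic : set R) (f x) by rewrite -fU; exists x.
move: cg; rewrite continuous_open_subspace; last exact: interval_open.
move=> cg.
have : nbhs (f x) (`]0, 1[ `&` g @^-1` (U° `&` N°)).
  apply: filterI; first by apply: open_nbhs_nbhs; split => //;
    exact: interval_open.
  apply: (cg _ (mem_set fxI)); rewrite gfx.
  by apply: filterI; exact: nbhs_interior.
move=> /nbhs_ballP[s /= s0 sI].
have fgB u : ball (f x) s u -> f (g u) = u.
  move=> /sI[+ _]; rewrite -fU => -[a Ua <-].
  by rewrite (fgK a) //; exact/mem_set.
have [|||g' [lg' g'0 g'B]] := sub_open_line (g := g) (t := f x) s0.
- by move=> u /sI[Iu _]; apply: cg; exact/mem_set.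
- by move=> u v Bu Bv guv; rewrite -(fgB u)// -(fgB v)// guv.
- move=> V oV VB; rewrite openE => _ [u Vu <-].
  have [Iu [Ugu _]] := sI u (VB u Vu).
  have cfu : \forall y \near g u, U y -> V (f y).
    have fguV : nbhs (f (g u)) V.
      by rewrite fgB; [exact: open_nbhs_nbhs|exact: VB].
    have /subspace_continuousP /(_ (g u) (interior_subset Ugu)) := cf.
    by move=> /(_ V fguV).
  have Uy : \forall y \near g u, U y by exact: Ugu.
  near=> y; have Uy' : U y by near: y.
  exists (f y); last by apply: fgK; exact/mem_set.
  by move: Uy'; near: y.
exists g'; split => //; first by rewrite g'0.
by rewrite g'B => _ [u /sI[_ [_ /interior_subset Nu]] <-].
Unshelve. all: by end_near. Qed.

Lemma open_line_O (g : R -> X) t : open_line g -> O_ X (g t).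
Proof.
move=> lg; exists (range g).
  by apply: open_line_nbhs => //; exact: filterT.
have [tau [ltau _ tauB]] :=
  @open_line_ball R (1 / 2) (1 / 2) ltac:(by rewrite divr_gt0).
have -> : `]0, 1[%classic = range tau.
  rewrite tauB; apply/seteqP; split=> r;
    rewrite -ball_normE/= in_itv/= ltr_norml.
    by move=> /andP[? ?]; apply/andP; split; lra.
  by move=> /andP[? ?]; apply/andP; split; lra.
exact: open_line_homeomorphic.
Qed.

Lemma O_open : open (O_ X).
Proof.
rewrite openE => x Ox; have [g [lg gx _]] := O_line Ox filterT.
rewrite /interior -gx; apply: filterS (open_line_nbhs (t := 0) lg filterT).
by move=> _ [t _ <-]; exact: open_line_O.
Qed.

Lemma C_closed : closed (C_ X).
Proof. exact: open_closedC O_open. Qed.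

Lemma homeo_C (h : homeo X) c : C_ X c -> C_ X (h c).
Proof.
move=> Cc Ohc; apply: Cc; have [g [[cg ig og] gx _]] := O_line Ohc filterT.
rewrite -(homeo_funK h c) -gx.
apply: (open_line_O (g := homeo_inv h \o g)); split.
- move=> r; apply: continuous_comp; first exact: cg.
  exact: homeo_inv_continuous.
- by apply: inj_comp => //; exact: can_inj (homeo_invK h).
- move=> V /og oV; rewrite -image_comp.
  have -> : homeo_inv h @` (g @` V) = h @^-1` (g @` V).
    apply/seteqP; split=> [_ [y Vy <-]|y Vhy]; first by rewrite /= homeo_invK.
    by exists (h y) => //; rewrite homeo_funK.
  by apply: open_comp => // r _; exact: homeo_fun_continuous.
Qed.

End open_lines_metric.

(** The induction principle on a connected set: a property that is locally
    constant and holds at one point holds everywhere. *)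
Lemma connected_propagate (T : topologicalType) (V : set T) (P : T -> Prop) x y
  :
  connected V ->
  (forall u, V u -> exists2 N, nbhs u N &
    forall z w, N z -> N w -> V z -> V w -> P z -> P w) ->
  V x -> V y -> P x -> P y.
Proof.
move=> cV HP Vx Vy Px.
suff : V `&` P = V by move=> VP; have [] : (V `&` P) y by rewrite VP.
apply: cV; first by exists x.
- exists (V `&` P `|` ~` V)°; first exact: open_interior.
  apply/seteqP; split=> [u [Vu Pu]|u [Vu /interior_subset [//|/(_ Vu)//]]].
  split=> //; have [N uN HN] := HP u Vu.
  have Nu := nbhs_singleton uN; apply: filterS uN => z Nz; have [Vz|] :=
    pselect (V z); last by right.
  by left; split=> //; exact: (HN u z).
- exists (closure (V `&` P)); first exact: closed_closure.
  apply/seteqP; split=> [u VPu|u [Vu cu]].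
    by split; [case: VPu|exact: subset_closure].
  split => //; have [N uN HN] := HP u Vu.
  have [z [[Vz Pz] Nz]] := cu N uN.
  by apply: (HN z u) => //; exact: nbhs_singleton.
Qed.

(** * Homogeneity of connected one-dimensional sets *)

(** Add to the identity the displacement t - s times a tent function centered at
    s. The slope of the tent times |t - s| is at most 1 / 2, so the sum is
    strictly increasing; surjectivity is the intermediate value theorem. *)
Lemma line_push (R : realType) (s t : R) : exists h : R -> R, exists k : R,
  [/\ continuous h, injective h, forall y, exists x, h x = y, h s = t &
      forall r, k <= `|r| -> h r = r].
Proof.
(* the half-width of the tent *)
pose m := 2 * `|t - s| + 1.
have m0 : 0 < m by rewrite /m; have := normr_ge0 (t - s); lra.
pose beta r := Num.max 0 (1 - `|r - s| / m).
pose h r := r + (t - s) * beta r.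
pose k := `|s| + m.
have ch : continuous h.
  move=> r; apply: cvgD; first exact: cvg_id.
  apply: cvgM; first exact: cvg_cst.
  apply: (@continuous_max _ _ (cst 0) (fun r => 1 - `|r - s| / m));
    first exact: cvg_cst.
  apply: cvgB; first exact: cvg_cst.
  apply: cvgM; last exact: cvg_cst.
  apply: (continuous_comp (f := fun r : R => r - s) (g := fun r : R => `|r|));
    last exact: norm_continuous.
  by apply: cvgB; [exact: cvg_id|exact: cvg_cst].
have hk r : k <= `|r| -> h r = r.
  move=> kr; rewrite /h /beta max_l ?mulr0 ?addr0// subr_le0 ler_pdivlMr//
    mul1r.
  by have := ler_normD (r - s) s; rewrite subrK /k in kr *; lra.
have beta_lip r q : r <= q -> `|beta q - beta r| <= (q - r) / m.
  move=> rq; have d0 : 0 <= (q - r) / m by rewrite divr_ge0 ?subr_ge0// ltW.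
  have a1 : `|q - s| / m <= `|r - s| / m + (q - r) / m.
    rewrite -mulrDl ler_pM2r ?invr_gt0//.
    by have := ler_normD (r - s) (q - r);
      rewrite [in X in X -> _](ger0_norm (_ : 0 <= q - r)) ?subr_ge0// addrC
        subrKA.
  have a2 : `|r - s| / m <= `|q - s| / m + (q - r) / m.
    rewrite -mulrDl ler_pM2r ?invr_gt0//.
    have := ler_normD (q - s) (r - q);
      rewrite -(opprB q r) normrN (ger0_norm (_ : 0 <= q - r)) ?subr_ge0//.
    by rewrite opprB addrC subrKA.
  rewrite /beta ler_norml; move: a1 a2 d0.
  move: (`|q - s| / m) (`|r - s| / m) ((q - r) / m) => a b c a1 a2 d0.
  rewrite /Num.max; case: ifP => /= [|/negbT]; case: ifP => /= [|/negbT];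
    rewrite -?leNgt => *;
    apply/andP; split; lra.
have hlt r q : r < q -> h r < h q.
  move=> rq; have am : `|t - s| / m <= 1 / 2 by rewrite ler_pdivrMr// /m; lra.
  have : `|(t - s) * (beta q - beta r)| <= 1 / 2 * (q - r).
    rewrite normrM; apply: (@le_trans _ _ (`|t - s| * ((q - r) / m))).
      by rewrite ler_wpM2l// beta_lip// ltW.
    by rewrite mulrCA mulrC ler_wpM2r// subr_ge0 ltW.
  by rewrite ler_norml mulrBr /h => /andP[? _]; lra.
exists h, k; split => //.
- move=> r q; case: (ltgtP r q) => // /hlt; last by move=> + e; rewrite e ltxx.
  by move=> + e; rewrite e ltxx.
- move=> y; have [ky|/ltW yk] := leP k `|y|; first by exists y; exact: hk.
  have k0 : 0 < k by rewrite /k; have := normr_ge0 s; lra.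
  have hkk : h k = k by apply: hk; rewrite ger0_norm// ltW.
  have hNkk : h (- k) = - k by apply: hk; rewrite normrN ger0_norm// ltW.
  have [|||c _ <-] := @IVT R h (- k) k y; last by exists c.
  + lra.
  + exact: continuous_subspaceT.
  + have Nkk : - k <= k by lra.
    by rewrite hkk hNkk (min_l Nkk) (max_r Nkk) -ler_norml.
- by rewrite /h /beta subrr normr0 mul0r subr0 max_r// mulr1 addrC subrK.
Qed.

Section homogeneity.
Context {R : realType} {X : metricType R}.
Hypothesis compactX : compact [set: X].

Lemma homeo_of_bijection (f : X -> X) : continuous f -> injective f ->
  (forall y, exists x, f x = y) -> exists h : homeo X, homeo_fun h = f.
Proof.
move=> cf injf /choice[f' f'K].
have fK : cancel f f' by move=> x; apply: injf; rewrite f'K.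
have cf' : continuous f'.
  apply/continuous_closedP => A cA.
  have -> : f' @^-1` A = f @` A.
    apply/seteqP; split=> [y Ay|_ [x Ax <-]]; first by exists (f' y).
    by rewrite /= fK.
  apply: compact_closed; first exact: metric_hausdorff.
  apply: continuous_compact; first exact: continuous_subspaceT.
  exact: subclosed_compact compactX _.
by exists (Homeo fK f'K cf cf').
Qed.

(** Transport a compactly supported homeomorphism of R along g and extend it by
    the identity. Continuity off the range of g holds because the support is
    compact, hence closed in X. *)
Lemma open_line_push (g : R -> X) s t : open_line g ->
  exists h : homeo X, h (g s) = g t /\ forall x, ~ range g x -> h x = x.
Proof.
move=> lg; have [cg ig _] := lg; have [f fK cf] := open_line_inv lg.
have [u [k [cu iu su ust uk]]] := line_push s t.
pose H x := if `[< range g x >] then g (u (f x)) else x.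
have Hg r : H (g r) = g (u r).
  by rewrite /H; case: asboolP => [_|[]]; [rewrite fK|exists r].
have Hid x : ~ range g x -> H x = x by rewrite /H; case: asboolP.
have [||y|h hH] := @homeo_of_bijection H.
- move=> x; have [[r _ <-]|gx] := pselect (range g x).
    move=> W; rewrite Hg => Wu.
    have : nbhs r ((g \o u) @^-1` W).
      by apply: (continuous_comp (f := u) (g := g)) => //;
        [exact: cu|exact: cg].
    move=> /(open_line_nbhs lg); apply: filterS => _ [q Wq <-].
    by rewrite /= Hg.
  move=> W; rewrite (Hid x gx) => Wx.
  have : open (~` (g @` `[- k, k])).
    apply: closed_openC; apply: compact_closed; first exact: metric_hausdorff.
    apply: continuous_compact; first exact: continuous_subspaceT.
    exact: segment_compact.
  move=> oK; have : nbhs x (~` (g @` `[- k, k])).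
    by apply: open_nbhs_nbhs; split => // -[r _ grx]; apply: gx; exists r.
  move=> /(filterI Wx); apply: filterS => y [Wy gy];
    suff Hy : H y = y by rewrite /= Hy.
  have [[r _ gr]|/Hid//] := pselect (range g y).
  rewrite -gr Hg uk// leNgt; apply/negP => rk; apply: gy; exists r => //.
  by move: rk; rewrite /= in_itv/= ltr_norml => /andP[? ?]; rewrite !ltW.
- move=> x y; have [[r _ <-]|gx] := pselect (range g x);
    have [[q _ <-]|gy] := pselect (range g y);
      rewrite ?Hg ?(Hid x)// ?(Hid y)//.
  + by move=> /ig /iu ->.
  + by move=> e; case: gy; exists (u r).
  + by move=> e; case: gx; exists (u q).
- have [[q _ <-]|gy] := pselect (range g y); last by exists y; exact: Hid.
  by have [r <-] := su q; exists (g r); rewrite Hg.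
by exists h; rewrite hH; split=> //; rewrite Hg ust.
Qed.

(** The points that x can be moved to are closed under moves inside a chart, hence
    exhaust the connected set V. *)
Lemma open_connected_homogeneous (V : set X) x y :
  connected V -> open V -> V `<=` O_ X -> V x -> V y ->
  exists h : homeo X, h x = y /\ forall z, ~ V z -> h z = z.
Proof.
move=> cV oV VO Vx Vy.
apply: (@connected_propagate X V (fun y => exists h : homeo X,
  h x = y /\ forall z, ~ V z -> h z = z) x y cV) => //; last by exists 1%g.
move=> u Vu; have [|g [lg gu gV]] := O_line (VO u Vu) (N := V).
  exact: open_nbhs_nbhs.
exists (range g).
  by rewrite -gu; apply: (open_line_nbhs lg); exact: filterT.
move=> _ _ [s _ <-] [t _ <-] _ _ [h [hx hV]].
have [k [kst kV]] := open_line_push s t lg.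
exists (k * h)%g; split; first by rewrite /= hx.
by move=> z Vz; rewrite /= hV// kV// => /gV.
Qed.

End homogeneity.

(** * Clopen circles *)

Lemma homeomorphic_sym (T U : topologicalType) (A : set T) (B : set U) :
  homeomorphic A B -> homeomorphic B A.
Proof.
move=> [f [g [fA gK cf cg]]]; exists g, f; split => //.
  rewrite -fA; apply/seteqP; split=> [_ [_ [x Ax <-] <-]|x Ax].
    by rewrite gK //; exact/mem_set.
  by exists (f x); [exists x|rewrite gK //; exact/mem_set].
by move=> y /set_mem; rewrite -fA => -[x Ax <-]; rewrite gK //; exact/mem_set.
Qed.

Lemma within_continuous_comp (T U W : topologicalType) (A : set T) (B : set U)
    (f : T -> U) (g : U -> W) : (forall x, A x -> B (f x)) ->
  {within A, continuous f} -> {within B, continuous g} ->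
  {within A, continuous (g \o f)}.
Proof.
move=> AB /subspace_continuousP cf /subspace_continuousP cg.
apply/subspace_continuousP => x Ax V /(cg (f x) (AB x Ax)).
move=> Vgfx; have near_x : \forall y \near x, A y -> B (f y) -> V (g (f y)).
  exact: cf Ax _ Vgfx.
suff : \forall y \near x, A y -> V (g (f y)) by [].
by apply: filterS near_x => y + Ay; apply => //; exact: AB.
Qed.

Lemma homeomorphic_trans (T U W : topologicalType) (A : set T) (B : set U)
    (D : set W) : homeomorphic A B -> homeomorphic B D -> homeomorphic A D.
Proof.
move=> AB BD; have [f [f' [fA f'K cf cf']]] := AB.
have [g [g' [gB g'K cg cg']]] := BD.
have fB x : A x -> B (f x) by move=> Ax; rewrite -fA; exists x.
exists (g \o f), (f' \o g'); split.
- by rewrite -image_comp fA.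
- move=> x /[dup] /set_mem Ax xA /=; rewrite g'K ?f'K //.
  exact/mem_set/fB.
- exact: within_continuous_comp fB cf cg.
- apply: within_continuous_comp cg' cf' => y.
  by rewrite -gB => -[x Bx <-]; rewrite g'K //; exact/mem_set.
Qed.

(** Exchange A and B along a homeomorphism between them; the map obtained is its
    own inverse. *)
Lemma homeo_swap (X : topologicalType) (A B : set X) :
  clopen A -> clopen B -> A `&` B = set0 -> homeomorphic A B ->
  exists h : homeo X, (forall x, A x -> B (h x)) /\
    forall x, ~ A x -> ~ B x -> h x = x.
Proof.
move=> [oA cA] [oB cB] AB [f [g [fA gK cf cg]]].
have fB x : A x -> B (f x) by move=> Ax; rewrite -fA; exists x.
have gA y : B y -> A (g y).
  by rewrite -fA => -[x Ax <-]; rewrite gK //; exact/mem_set.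
have fK y : B y -> f (g y) = y.
  by rewrite -fA => -[x Ax <-]; rewrite gK //; exact/mem_set.
have nAB x : A x -> B x -> False.
  by move=> Ax Bx; have : (A `&` B) x by []; rewrite AB.
pose H x := if `[< A x >] then f x else if `[< B x >] then g x else x.
have HA x : A x -> H x = f x by rewrite /H; case: asboolP.
have HB x : B x -> H x = g x.
  by move=> Bx; rewrite /H; case: asboolP => [/nAB/(_ Bx)|_] //; case: asboolP.
have HN x : ~ A x -> ~ B x -> H x = x.
  by rewrite /H; case: asboolP => // _; case: asboolP.
have HK : cancel H H.
  move=> x; have [Ax|nAx] := pselect (A x).
    by rewrite (HA x)// (HB _ (fB x Ax)) gK //; exact/mem_set.
  have [Bx|nBx] := pselect (B x); last by rewrite !HN.
  by rewrite (HB x)// (HA _ (gA x Bx)) fK.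
have cH : continuous H.
  have loc (V : set X) (k : X -> X) x : open V -> V x -> (forall y,
    V y -> H y = k y) ->
      {for x, continuous k} -> {for x, continuous H}.
    move=> oV Vx Hk ck W; rewrite (Hk x Vx) => /ck;
      have : nbhs x V by exact: open_nbhs_nbhs.
    move=> xV kW; have : \forall y \near x, V y /\
      W (k y) by exact: filterI xV kW.
    suff : forall y, V y /\ W (k y) -> W (H y) by move=> VW;
      exact: (@filterS _ (nbhs x) _ _ _ VW).
    by move=> y [/Hk ->].
  move=> x; have [Ax|nAx] := pselect (A x).
    apply: (loc A f) => //.
    by move: cf; rewrite continuous_open_subspace// => /(_ x (mem_set Ax)).
  have [Bx|nBx] := pselect (B x).
    apply: (loc B g) => //.
    by move: cg; rewrite continuous_open_subspace// => /(_ x (mem_set Bx)).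
  apply: (loc (~` A `&` ~` B) id) => //.
  - by apply: openI; exact: closed_openC.
  - by move=> y [] /HN/[apply].
exists (Homeo HK HK cH cH); split=> [x Ax|x] /=; last exact: HN.
by rewrite HA//; exact: fB.
Qed.

Lemma connected_clopen (T : topologicalType) (A B : set T) :
  connected B -> clopen A -> A `&` B !=set0 -> B `<=` A.
Proof.
move=> cB [oA cA] AB; suff <- : B `&` A = B by exact: subIsetr.
by apply: cB; [rewrite setIC|exists A|exists A].
Qed.

Section circles.
Context {R : realType}.

(* Stereographic parametrizations of the circle minus a point: for p = 1 the
   missing point is (-1, 0), for p = -1 it is (1, 0). The inverse is
   (x, y) |-> p y / (1 + p x). *)
Let arc (p t : R) : R * R :=
  (p * ((1 - t ^+ 2) / (1 + t ^+ 2)), p * (2 * t / (1 + t ^+ 2))).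

Let arc_den (t : R) : 1 + t ^+ 2 != 0.
Proof. by rewrite gt_eqF// ltr_pwDl// sqr_ge0. Qed.

Let arc_circle p t : p ^+ 2 = 1 -> unit_circle R (arc p t).
Proof.
move=> p1; rewrite /unit_circle/= !exprMn p1 !mul1r; field.
exact: arc_den.
Qed.

Let arcK p t : p ^+ 2 = 1 -> p * (arc p t).2 / (1 + p * (arc p t).1) = t.
Proof.
move=> p1; rewrite /arc/= !mulrA -!expr2 p1 !mul1r.
have -> : 1 + (1 - t ^+ 2) / (1 + t ^+ 2) = 2 / (1 + t ^+ 2).
  by field; exact: arc_den.
by field; rewrite arc_den.
Qed.

Let arc_den2 p t : p ^+ 2 = 1 -> 1 + p * (arc p t).1 != 0.
Proof.
move=> p1; rewrite /arc/= !mulrA -!expr2 p1 !mul1r.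
have -> : 1 + (1 - t ^+ 2) / (1 + t ^+ 2) = 2 / (1 + t ^+ 2).
  by field; exact: arc_den.
by rewrite mulf_neq0// invr_neq0// arc_den.
Qed.

Let arcVK p v : p ^+ 2 = 1 -> unit_circle R v -> 1 + p * v.1 != 0 ->
  arc p (p * v.2 / (1 + p * v.1)) = v.
Proof.
case: v => x y /= p1 xy d0.
have y2 : y ^+ 2 = 1 - x ^+ 2.
  have xy1 : x ^+ 2 + y ^+ 2 = 1 by [].
  by rewrite -xy1 addrAC subrr add0r.
have t2 : 1 + (p * y / (1 + p * x)) ^+ 2 = 2 / (1 + p * x).
  rewrite !exprMn p1 mul1r y2 exprVn.
  by move: p1 d0 => /eqP; rewrite sqrf_eq1 => /orP[] /eqP ->; rewrite ?(mul1r,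
    mulN1r) => d0; field.
have u2 : 1 - (p * y / (1 + p * x)) ^+ 2 = 2 * (p * x) / (1 + p * x).
  have -> : 1 - (p * y / (1 + p * x)) ^+ 2 = 2 - (1 + (p * y / (1 + p * x)) ^+
    2).
    by ring.
  by rewrite t2; field.
rewrite /arc t2 u2; congr (_, _).
  have -> : 2 * (p * x) / (1 + p * x) / (2 / (1 + p * x)) = p * x by field.
  by rewrite mulrA -expr2 p1 mul1r.
have -> : 2 * (p * y / (1 + p * x)) / (2 / (1 + p * x)) = p * y by field.
by rewrite mulrA -expr2 p1 mul1r.
Qed.

Let arc_continuous p : continuous (arc p).
Proof.
move=> t; have cden : {for t, continuous (fun t : R => (1 + t ^+ 2)^-1)}.
  apply: cvgV; first exact: arc_den.
  by apply: cvgD; [exact: cvg_cst|exact: exprn_continuous].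
have c1 : {for t, continuous (fun t : R => p * ((1 - t ^+ 2) / (1 + t ^+ 2)))}.
  apply: cvgM; first exact: cvg_cst.
  apply: cvgM => //.
  by apply: cvgB; [exact: cvg_cst|exact: exprn_continuous].
have c2 : {for t, continuous (fun t : R => p * (2 * t / (1 + t ^+ 2)))}.
  apply: cvgM; first exact: cvg_cst.
  apply: cvgM => //.
  by apply: cvgM; [exact: cvg_cst|exact: cvg_id].
exact: cvg_pair c1 c2.
Qed.

Section circle_lines.
Variables (X : topologicalType) (A : set X).
Hypotheses (oA : open A) (circA : homeomorphic A (unit_circle R)).

(** Two lines are enough to see that a circle is connected and that its points
    are one-dimensional points of the space. *)
Lemma circle_open_lines : exists g h : R -> X,
  [/\ open_line g, open_line h, range g `&` range h !=set0 &
      range g `|` range h = A].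
Proof.
have [phi [psi [phiA psiK cphi cpsi]]] := circA.
have phiC x : A x -> unit_circle R (phi x) by move=> Ax; rewrite -phiA;
  exists x.
have phiK v : unit_circle R v -> phi (psi v) = v.
  by rewrite -phiA => -[x Ax <-]; rewrite psiK //; exact/mem_set.
have psiA v : unit_circle R v -> A (psi v).
  by rewrite -phiA => -[x Ax <-]; rewrite psiK //; exact/mem_set.
have line p : p ^+ 2 = 1 -> open_line (psi \o arc p).
  move=> p1; split.
  - move=> t W /= Wt; move/subspace_continuousP: cpsi.
    move=> /(_ _ (arc_circle t p1) _ Wt) Wpsi.
    have near_t : \forall q \near t,
      unit_circle R (arc p q) -> W (psi (arc p q)).
      exact: arc_continuous Wpsi.
    suff : \forall q \near t, W (psi (arc p q)) by [].
    by apply: filterS near_t => q; apply; exact: (arc_circle q p1).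
  - move=> t q /= /(congr1 phi); rewrite !phiK; try exact: arc_circle.
    by move=> e; rewrite -(arcK t p1) e arcK.
  - move=> V oV; rewrite openE => _ [t Vt <-] /=.
    have At : A (psi (arc p t)) by exact/psiA/arc_circle.
    have cphit : {for psi (arc p t), continuous phi}.
      by move: cphi; rewrite continuous_open_subspace// => /(_ _ (mem_set At)).
    have cden : {for psi (arc p t), continuous (fun y => 1 + p * (phi y).1)}.
      apply: cvgD; first exact: cvg_cst.
      apply: cvgM; first exact: cvg_cst.
      exact: (continuous_comp cphit (@cvg_fst _ _ _ _ _)).
    have cnum : {for psi (arc p t), continuous (fun y =>
      p * (phi y).2 / (1 + p * (phi y).1))}.
      apply: cvgM; last by apply: cvgV => //; rewrite phiK ?arc_den2//;
        exact: arc_circle.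
      apply: cvgM; first exact: cvg_cst.
      exact: (continuous_comp cphit (@cvg_snd _ _ _ _ _)).
    have nA : \forall y \near psi (arc p t), A y by exact: open_nbhs_nbhs.
    have nd : \forall y \near psi (arc p t), 1 + p * (phi y).1 != 0.
      have : nbhs (1 + p * (phi (psi (arc p t))).1) [set r | r != 0].
        apply: open_nbhs_nbhs; split; first exact: open_neq.
        by rewrite /= phiK ?arc_den2//; exact: arc_circle.
      by move=> /cden.
    have nV : \forall y \near psi (arc p t),
      V (p * (phi y).2 / (1 + p * (phi y).1)).
      have : nbhs (p * (phi (psi (arc p t))).2 / (1 + p * (phi (psi (arc p
        t))).1)) V.
        rewrite phiK ?arcK//; last exact: arc_circle.
        exact: open_nbhs_nbhs.
      by move=> /cnum.
    near=> y; exists (p * (phi y).2 / (1 + p * (phi y).1)); first by near: y.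
    rewrite /= arcVK//; [|by apply: phiC; near: y|by near: y].
    by apply: psiK; apply/mem_set; near: y.
have p1 : (1 : R) ^+ 2 = 1 by rewrite expr1n.
have pN1 : (-1 : R) ^+ 2 = 1 by rewrite sqrrN expr1n.
exists (psi \o arc 1), (psi \o arc (-1)); split; try exact: line.
- exists (psi (arc 1 1)); split; first by exists 1.
  exists (-1) => //; congr psi; congr (_, _); rewrite sqrrN expr1n;
    first by rewrite subrr !mul0r !mulr0.
  by rewrite mul1r mulN1r mulrN mulNr opprK.
- apply/seteqP; split=> [_ [] [t _ <-]|x Ax]; try by apply: psiA;
  exact: arc_circle.
  have xK : psi (phi x) = x by apply: psiK; exact/mem_set.
  have [e|ne] := eqVneq (1 + 1 * (phi x).1) 0.
    right; exists (-1 * (phi x).2 / (1 + -1 * (phi x).1)) => //=.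
    rewrite arcVK ?xK//; first exact: phiC.
    apply/eqP; lra.
  left; exists (1 * (phi x).2 / (1 + 1 * (phi x).1)) => //=.
  by rewrite arcVK ?xK//; exact: phiC.
Unshelve. all: by end_near. Qed.

Lemma circle_connected : connected A.
Proof.
have [g [h [lg lh gh <-]]] := circle_open_lines.
apply: connectedU => //; [move: lg|move: lh] => l;
  apply: (open_line_connected l); by apply/connected_intervalP => x y _ _ z _.
Qed.

End circle_lines.

Lemma circle_O (X : metricType R) (A : set X) :
  open A -> homeomorphic A (unit_circle R) -> A `<=` O_ X.
Proof.
move=> oA circA; have [g [h [lg lh gh <-]]] := circle_open_lines oA circA.
by move=> _ [] [t _ <-]; exact: open_line_O.
Qed.

End circles.

(** * Displacements supported near C, and limits of circles *)

Section strictness.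
Context {R : realType} {X : metricType R}.
Hypothesis compactX : compact [set: X].
Local Notation C := (C_ X).

(** The homeomorphisms with displacement bounded by some c < eta form a tau_k-open
    neighborhood of the identity that contains no B_tau_kC C e. *)
Lemma tau_kC_neq (eta : R) : 0 < eta ->
  (forall e, 0 < e -> exists2 h : homeo X, B_tau_kC C e h &
     exists x, eta <= mdist x (h x)) ->
  tau_kC C <> tau_k X.
Proof.
move=> eta0 far tauE.
pose U := [set h : homeo X | exists2 c, c < eta & forall x, mdist x (h x) <= c].
have : tau_k X U.
  apply/tau_kP => // h [c ceta hc]; exists ((eta - c) / 2).
    by rewrite divr_gt0// subr_gt0.
  move=> k hk; exists ((c + eta) / 2); first lra.
  move=> x; have := metric_triangle x (h x) (k x).
  by have := hc x; have := hk x; lra.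
rewrite -tauE => /(tau_kCP compactX (@homeo_C R X))/(_ 1%g)[].
  by exists 0 => // x; rewrite /= mdistxx.
move=> e e0 BU; have [h Bh [x etax]] := far e e0.
have [c ceta hc] := BU h Bh; have := hc x; rewrite mul1g.
by move=> /(le_trans etax)/(lt_le_trans ceta); rewrite ltxx.
Qed.

Lemma homeo_B_tau_kC (V : set X) e (h : homeo X) : 0 < e ->
  V `<=` thickening C e -> (forall z, ~ V z -> h z = z) -> B_tau_kC C e h.
Proof.
move=> e0 VC hV x xe; have hx : h x = x by apply: hV => /VC.
split; first by rewrite hx mdistxx.
suff -> : (h^-1)%g x = x by rewrite mdistxx.
by rewrite -{1}hx; exact: homeo_funK.
Qed.

Lemma move_in_thickening (V : set X) e x y : 0 < e ->
  connected V -> open V -> V `<=` O_ X -> V `<=` thickening C e ->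
  V x -> V y -> exists2 h : homeo X, B_tau_kC C e h & h x = y.
Proof.
move=> e0 cV oV VO VC Vx Vy.
have [h [hxy hV]] := open_connected_homogeneous compactX cV oV VO Vx Vy.
by exists h => //; exact: homeo_B_tau_kC VC hV.
Qed.

Definition clopen_circle (A : set X) : Prop := clopen A /\
  homeomorphic A (unit_circle R).

Lemma clopen_circle_sub A B : clopen_circle A -> clopen_circle B ->
  A `&` B !=set0 -> B `<=` A.
Proof.
move=> [cA _] [[oB _] hB]; apply: connected_clopen => //.
exact: circle_connected hB.
Qed.

(** Let K be the compact set of points far from C. A point k of K has a connected
    neighborhood, which is either disjoint from all clopen circles or contained
    in one of them, say A. In the second case A does not contain p, and a circle
    passing near enough to p is disjoint from A, hence from this neighborhood of
    k. By compactness, circles passing near enough to p avoid K. *)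
Lemma circle_near e (p : X) (N : set X) : 0 < e -> closure (S_ X) p -> C p ->
  nbhs p N -> exists A a, [/\ clopen_circle A, A `<=` thickening C e,
    A a & N a].
Proof.
move=> e0 Sp Cp Np.
have [q [[A [cA Aq hA]] [Nq Aq']]] : (S_ X `&` (N `&`
    [set q | ~` thickening C e `<=`
      (fun k => forall A, clopen_circle A -> A q -> ~ A k)])) !=set0.
  apply: Sp; apply: filterI => //.
  have /compact_near_coveringP cov := @thickeningC_compact _ _ compactX C e.
  apply: (cov _ (nbhs p)) => k ke.
  have Ok : O_ X k.
    by apply: contrapT => Ck; apply: ke; apply/thickeningP; exists k => //;
      rewrite mdistxx.
  have [g [lg gk _]] := O_line Ok filterT.
  have cg : connected (range g).
    apply: (open_line_connected lg).
    by apply/connected_intervalP => x y _ _ z _.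
  have kg : nbhs k (range g) by rewrite -gk; apply: open_line_nbhs => //;
    exact: filterT.
  have [[A [cA Ak hA]]|noA] := pselect (exists A, [/\ clopen A,
    A k & homeomorphic A (unit_circle R)]).
    have Ap : ~ A p by move=> Ap; apply: Cp; apply: circle_O Ap => //; case: cA.
    exists (A, ~` A) => /=.
      split; first by apply: open_nbhs_nbhs; split => //; case: cA.
      by apply: open_nbhs_nbhs; split => //; apply: closed_openC; case: cA.
    move=> [k' q] /= [Ak' Aq] B cB Bq Bk'; apply: Aq.
    by apply: (@clopen_circle_sub A B) => //; exists k'.
  exists (range g, setT) => /=; first by split => //; exact: filterT.
  move=> [k' q] /= [gk' _] B [cB hB] Bq Bk'; apply: noA; exists B; split => //.
  apply: (connected_clopen cg cB); last by rewrite -gk; exists 0.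
  by exists k'.
exists A, q; split => // k Ak; apply: contrapT => ke.
by have := Aq' k ke A; apply.
Qed.

(** The diameters of the circles need not tend to 0, so exchanging two circles may
    fail to displace any point much; a chosen point near p is therefore moved
    to a chosen point near q in a second step, inside the second circle. *)
Lemma two_circle_limits (p q : X) : p <> q ->
  closure (S_ X) p -> C p -> closure (S_ X) q -> C q -> tau_kC C <> tau_k X.
Proof.
move=> pq Sp Cp Sq Cq.
have D0 : 0 < mdist p q by rewrite mdist_gt0; exact/eqP.
have D40 : 0 < mdist p q / 4 by rewrite divr_gt0.
apply: (@tau_kC_neq (mdist p q / 2)); first by rewrite divr_gt0.
move=> e e0.
have [A [a [cA Ae Aa pa]]] := circle_near e0 Sp Cp (mdist_near p D40).
have [B [b [cB Be Bb qb]]] := circle_near e0 Sq Cq (mdist_near q D40).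
have [[oA _] hA] := cA; have [[oB _] hB] := cB.
have far : mdist p q / 2 <= mdist a b.
  have := metric_triangle p a q; have := metric_triangle a b q.
  by rewrite (metric_sym b q); lra.
have conA := circle_connected oA hA; have conB := circle_connected oB hB.
have [AB|/set0P/negP/negPn/eqP AB] := pselect (A `&` B !=set0).
  have BA : B `<=` A by exact: clopen_circle_sub AB.
  have [h Bh hab] := move_in_thickening e0 conA oA (circle_O oA hA) Ae Aa (BA b
    Bb).
  by exists h => //; exists a; rewrite hab.
have [k [kAB kid]] := homeo_swap cA.1 cB.1 AB
  (homeomorphic_trans hA (homeomorphic_sym hB)).
have [h [hkab hid]] := open_connected_homogeneous compactX conB oB
  (circle_O oB hB) (kAB a Aa) Bb.
exists (h * k)%g; last by exists a; rewrite /= hkab.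
apply: (@homeo_B_tau_kC (A `|` B)) => //; first by move=> z [/Ae|/Be].
move=> z ABz; have [Az Bz] : ~ A z /\ ~ B z by split=> ?; apply: ABz;
  [left|right].
by rewrite /= kid// hid.
Qed.

End strictness.

(** * Compact sets with at most two boundary points *)

Section two_ended.
Context {R : realType} {X : metricType R}.
Implicit Types (M A : set X) (g : R -> X).

(** A stand-in for being a nondegenerate segment, or a circle, that needs no
    parametrization. The last clause puts a piece of M on one side of each boundary
    point; at an isolated point, an arc could be glued on both sides and the
    number of boundary points could grow. *)
Definition two_ended M : Prop :=
  [/\ compact M, exists b1 b2, M `\` M° `<=` [set b1; b2] &
      forall x, M x -> exists A, [/\ connected A, A `<=` M,
        A x & A <> [set x]]].

Lemma two_ended_closed M : two_ended M -> closed M.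
Proof. by case=> cM _ _; apply: compact_closed => //;
  exact: metric_hausdorff. Qed.

Lemma open_line_segment_compact g a b : open_line g -> compact (g @` `[a, b]).
Proof.
move=> [cg _ _]; apply: continuous_compact; last exact: segment_compact.
exact: continuous_subspaceT.
Qed.

Lemma open_line_itv_open g a b : open_line g -> open (g @` `]a, b[).
Proof. by move=> [_ _ og]; apply: og; exact: interval_open. Qed.

Lemma open_line_segment_connected g a b : open_line g -> connected (g @` `[a,
  b]).
Proof. by move=> lg; apply: open_line_connected lg _;
  exact: segment_connected. Qed.

Lemma open_line_avoid g p : open_line g ->
  exists2 s, 0 < s & forall t, g t = p -> t = 0 \/ s <= `|t|.
Proof.
move=> [_ ig _]; have [[t gt]|np] := pselect (exists t, g t = p); last first.
  by exists 1 => // t gt; case: np; exists t.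
have [t0|t0] := eqVneq t 0.
  by exists 1 => // u gu; left; apply: ig; rewrite gu -gt t0.
exists `|t|; first by rewrite normr_gt0.
by move=> u gu; right; have -> : u = t by apply: ig; rewrite gu.
Qed.

(** Otherwise points outside M accumulate at g 0 from both sides, and two of them
    cut out of A a clopen part contained in an arbitrarily small arc around
    g 0. *)
Lemma connected_one_sided g A M : open_line g -> connected A -> A `<=` M ->
  A (g 0) -> A <> [set g 0] ->
  (exists2 s, 0 < s & forall t, 0 <= t < s -> M (g t)) \/
  (exists2 s, 0 < s & forall t, 0 <= t < s -> M (g (- t))).
Proof.
move=> lg cA AM A0 An; have [_ ig _] := lg.
have [a Aa a0] : exists2 a, A a & a <> g 0.
  apply: contrapT => H; apply: An; apply/seteqP; split=> [a Aa|_ ->//].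
  by apply: contrapT => a0; apply: H; exists a.
have [s s0 as_] := open_line_avoid a lg.
apply: contrapT => /not_orP[nr nl].
have [w2 w2s nw2] : exists2 t, 0 <= t < s & ~ M (g t).
  apply: contrapT => H; apply: nr; exists s => // t ts.
  by apply: contrapT => Mt; apply: H; exists t.
have [w1 w1s nw1] : exists2 t, 0 <= t < s & ~ M (g (- t)).
  apply: contrapT => H; apply: nl; exists s => // t ts.
  by apply: contrapT => Mt; apply: H; exists t.
have w1p : 0 < w1.
  rewrite lt_neqAle; case/andP: w1s => -> _; rewrite andbT; apply/eqP => e.
  by apply: nw1; rewrite -e oppr0; exact: AM.
have w2p : 0 < w2.
  rewrite lt_neqAle; case/andP: w2s => -> _; rewrite andbT; apply/eqP => e.
  by apply: nw2; rewrite -e; exact: AM.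
have : A `&` (g @` `]- w1, w2[) = A.
  apply: cA.
  - by exists (g 0); split=> //; exists 0 => //;
    rewrite /= in_itv/= oppr_lt0 w1p.
  - by exists (g @` `]- w1, w2[) => //; exact: open_line_itv_open.
  - exists (g @` `[- w1, w2]).
      apply: compact_closed; first exact: metric_hausdorff.
      exact: open_line_segment_compact.
    apply/seteqP; split=> y [Ay [t tw gy]]; split=> //; exists t => //;
      rewrite -gy in Ay.
      by move: tw; rewrite /= !in_itv/= => /andP[? ?]; rewrite !ltW.
    move: tw; rewrite /= !in_itv/= !le_eqVlt => /andP[/orP[/eqP e|->]]/=.
      by case: nw1; rewrite e; exact: AM.
    by move=> /orP[/eqP e|->//]; case: nw2; rewrite -e; exact: AM.
move=> AE; have [_ [t tw gta]] : (A `&` (g @` `]- w1, w2[)) a by rewrite AE.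
case: (as_ t gta) => [t0|]; first by apply: a0; rewrite -gta t0.
apply/negP; rewrite -ltNge ltr_norml; move: tw w1s w2s; rewrite /= in_itv/=.
by move=> /andP[? ?] /andP[? ?] /andP[? ?]; apply/andP; split; lra.
Qed.

(** If the far end g b of the arc is not in M, let g d be the last point of the arc
    in M. It is a boundary point of M, and M occupies its other side, so it
    becomes interior once the arc is added: the new boundary point g b takes the
    place of g d. *)
Lemma two_ended_half_arc g M b : open_line g -> two_ended M -> M (g 0) ->
  0 <= b -> two_ended (M `|` g @` `[0, b]).
Proof.
move=> lg tM M0 b0; have [cM [b1 [b2 Mb]] Mnd] := tM; have [cg ig og] := lg.
have clM := two_ended_closed tM.
set J := g @` `[0, b].
have cJ : compact J by exact: open_line_segment_compact.
have JP t : 0 <= t <= b -> J (g t) by move=> tb; exists t => //;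
  rewrite /= in_itv.
have bdJ x : J x -> ~ M x -> ~ (M `|` J)° x -> x = g b.
  move=> [t tb <-] nMt nint; move: tb; rewrite /= in_itv/= => /andP[t0 tb].
  have [->//|tnb] := eqVneq t b; case: nint.
  have {}t0 : 0 < t.
    by rewrite lt_neqAle t0 andbT; apply/eqP => e; apply: nMt; rewrite -e.
  have {}tb : t < b by rewrite lt_neqAle tnb.
  have : nbhs (g t) (g @` `]0, b[).
    apply: open_nbhs_nbhs; split; first exact: open_line_itv_open.
    by exists t => //; rewrite /= in_itv/= t0.
  apply: filterS => _ [u ub <-]; move: ub; rewrite /= in_itv/= => /andP[u0 ub];
    right; apply: JP.
  by rewrite !ltW.
have bdM x : M x -> ~ (M `|` J)° x -> ~ M° x.
  by move=> _ nint Mx; apply: nint; apply: (interiorS _ Mx) => y; left.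
split.
- exact: compactU.
- have [Mgb|nMgb] := pselect (M (g b)).
    exists b1, b2 => x [MJx nint]; apply: Mb.
    have Mx : M x.
      apply: contrapT => nMx; have Jx : J x by case: MJx.
      by have := nMx; rewrite (bdJ x Jx nMx nint).
    by split=> //; exact: bdM nint.
  pose T := [set t | 0 <= t <= b /\ M (g t)].
  have T0 : T 0 by split=> //; rewrite lexx.
  have ubT : ubound T b by move=> t [/andP[]].
  have supT : has_sup T by split; [exists 0|exists b].
  pose d := sup T.
  have clT : closed T.
    have -> : T = `[0, b] `&` g @^-1` M.
      by apply/seteqP; split=> t /=; rewrite in_itv/=.
    apply: closedI; first exact: interval_closed.
    by apply: preimage_closed => // t _; exact: cg.
  have Td : T d.
    apply: clT; apply: closure_sup => //; first by exists 0.
    by exists b.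
  have [/andP[d0 db] Md] := Td.
  have {}db : d < b.
    by rewrite lt_neqAle db andbT; apply/eqP => e; apply: nMgb; rewrite -e.
  have dmax t : d < t <= b -> ~ M (g t).
    move=> /andP[dt tb] Mt; have : t <= d.
      by apply: ub_le_sup; [exists b|split=> //;
        rewrite tb (le_trans d0)// ltW].
    by rewrite leNgt dt.
  have nMint : ~ M° (g d).
    move=> /(cg d)/nbhs_ballP[r /= r0 rM].
    pose t := d + Num.min (b - d) (r / 2).
    have m0 : 0 < Num.min (b - d) (r / 2) by rewrite lt_min subr_gt0 db
      divr_gt0.
    have m1 : Num.min (b - d) (r / 2) <= b - d by rewrite ge_min lexx.
    have m2 : Num.min (b - d) (r / 2) <= r / 2 by rewrite ge_min lexx orbT.
    apply: (dmax t); first by rewrite /t; apply/andP; split; lra.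
    apply: rM; rewrite -ball_normE/= /t opprD addNKr normrN gtr0_norm//; lra.
  have int : (M `|` J)° (g d).
    have lgd := open_line_shift d lg.
    have [A [cA AM Ad And]] := Mnd _ Md.
    have [||[s s0 sM]|[s s0 sM]] := @connected_one_sided (fun r =>
      g (d + r)) A M lgd cA AM.
    - by rewrite addr0.
    - by rewrite addr0.
    - case: (dmax (d + Num.min (b - d) (s / 2))).
        have m0 : 0 < Num.min (b - d) (s / 2) by rewrite lt_min subr_gt0 db
          divr_gt0.
        have m1 : Num.min (b - d) (s / 2) <= b - d by rewrite ge_min lexx.
        by apply/andP; split; lra.
      apply: sM; rewrite le_min gt_min subr_ge0 (ltW db) divr_ge0 ?ltW//=.
      by apply/orP; right; lra.
    - have : nbhs (g d) (g @` `]d - s, b[).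
        apply: open_nbhs_nbhs; split; first exact: open_line_itv_open.
        by exists d => //; rewrite /= in_itv/= db andbT; lra.
      apply: filterS => _ [u ub <-]; move: ub; rewrite /= in_itv/= =>
        /andP[u0 ub].
      have [ud|du] := leP u d.
        left; have -> : u = d + - (d - u) by lra.
        by apply: sM; apply/andP; split; lra.
      by right; apply: JP; apply/andP; split; lra.
  have [b3 Mb3] : exists b3, M `\` M° `<=` [set g d; b3].
    have [gb|gb] : [set b1; b2] (g d) by apply: Mb.
      by exists b2; rewrite gb.
    by exists b1; rewrite setUC gb.
  exists (g b), b3 => x [MJx nint].
  have [Mx|nMx] := pselect (M x); last first.
    by left; apply: bdJ => //; case: MJx.
  have [xd|->] : [set g d; b3] x by apply: Mb3; split=> //; exact: bdM nint.
    by case: nint; rewrite xd.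
  by right.
- move=> x [Mx|Jx].
    by have [A [cA AM Ax Ax1]] := Mnd x Mx; exists A; split=> // y /AM; left.
  have [Mx|nMx] := pselect (M x).
    by have [A [cA AM Ax Ax1]] := Mnd x Mx; exists A; split=> // y /AM; left.
  exists J; split=> //; first exact: open_line_segment_connected.
  move=> Jx1; apply: nMx; suff <- : g 0 = x by [].
  have : J (g 0) by apply: JP; rewrite lexx.
  by rewrite Jx1.
Qed.

(** Cut the arc at a point of M and glue the two halves one after the other. *)
Lemma two_ended_arc g M t : open_line g -> two_ended M -> M (g t) ->
  -1 <= t <= 1 -> two_ended (M `|` g @` `[-1, 1]).
Proof.
move=> lg tM Mt /andP[t1 t2].
have lr := open_line_shift t lg; have ll := open_line_opp lr.
have b1 : 0 <= 1 - t by lra.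
have b2 : 0 <= 1 + t by lra.
have Mt' : M (g (t + 0)) by rewrite addr0.
have tM1 := two_ended_half_arc lr tM Mt' b1.
have tM2 := two_ended_half_arc ll tM1 _ b2.
move: tM2; rewrite oppr0 => /(_ (or_introl Mt')).
rewrite -setUA; congr (two_ended (_ `|` _)).
apply/seteqP; split=> [y []|y [r rb <-]].
- move=> [r rb <-]; move: rb; rewrite /= in_itv/= => /andP[? ?];
  exists (t + r) => //.
  by rewrite /= in_itv/=; apply/andP; split; lra.
- move=> [r rb <-]; move: rb; rewrite /= in_itv/= => /andP[? ?];
  exists (t - r) => //.
  by rewrite /= in_itv/=; apply/andP; split; lra.
- move: rb; rewrite /= in_itv/= => /andP[? ?]; have [tr|rt] := leP t r.
    left; exists (r - t); last by rewrite addrC subrK.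
    by rewrite /= in_itv/=; apply/andP; split; lra.
  right; exists (t - r); last by rewrite opprB addrC subrK.
  by rewrite /= in_itv/=; apply/andP; split; lra.
Qed.

Lemma two_ended_line g : open_line g -> two_ended (g @` `[-1, 1]).
Proof.
move=> lg; split.
- exact: open_line_segment_compact.
- exists (g (-1)), (g 1) => x [[t tb <-] nint]; move: tb;
  rewrite /= in_itv/= => /andP[t1 t2].
  have [->|n1] := eqVneq t (-1); first by left.
  have [->|n2] := eqVneq t 1; first by right.
  case: nint; have : nbhs (g t) (g @` `]-1, 1[).
    apply: open_nbhs_nbhs; split; first exact: open_line_itv_open.
    by exists t => //; rewrite /= in_itv/= !lt_neqAle t1 t2 n2 eq_sym n1.
  apply: filterS; apply: image_subset => u /=; rewrite !in_itv/= => /andP[? ?].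
  by rewrite !ltW.
- move=> x xg; exists (g @` `[-1, 1]); split=> //.
    exact: open_line_segment_connected.
  move=> gx; have [_ ig _] := lg.
  have g1 : (g @` `[-1, 1]) (g 1) by exists 1 => //; rewrite /= in_itv/=;
    apply/andP; split; lra.
  have g0 : (g @` `[-1, 1]) (g 0) by exists 0 => //; rewrite /= in_itv/=;
    apply/andP; split; lra.
  rewrite gx in g1 g0; have /ig/eqP : g 1 = g 0 by rewrite [LHS]g1 g0.
  by rewrite oner_eq0.
Qed.

Variable I : set X.
Hypotheses (oI : open I) (cI : connected I) (IO : I `<=` O_ X).

Let line_in (V : set X) x : open V -> V `<=` I -> V x ->
  exists g, [/\ open_line g, g 0 = x & range g `<=` V].
Proof.
by move=> oV VI Vx; apply: O_line; [exact/IO/VI|exact: open_nbhs_nbhs].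
Qed.

Lemma two_ended_absorb_point M x : two_ended M -> M `<=` I -> M !=set0 -> I x ->
  exists M', [/\ two_ended M', M' `<=` I, M `<=` M' & M' x].
Proof.
move=> tM MI [m Mm] Ix.
apply: (@connected_propagate X I (fun x => exists M', [/\ two_ended M',
  M' `<=` I, M `<=` M' & M' x]) m x cI) => //; [|exact: MI|by exists M; split].
move=> u Iu; have [g [lg gu gI]] := line_in oI (@subset_refl _ I) Iu.
exists (g @` `]-1, 1[).
  rewrite -gu; apply: open_nbhs_nbhs; split; first exact: open_line_itv_open.
  by exists 0 => //; rewrite /= in_itv/=; apply/andP; split; lra.
move=> _ _ [s sb <-] [t tb <-] _ _ [M' [tM' M'I MM' M's]].
move: sb tb; rewrite /= !in_itv/= => /andP[s1 s2] /andP[t1 t2].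
exists (M' `|` g @` `[-1, 1]); split.
- by apply: (two_ended_arc lg tM' M's); rewrite !ltW.
- by move=> y [/M'I//|[r _ <-]]; apply: gI; exists r.
- by move=> y /MM'; left.
- by right; exists t => //; rewrite /= in_itv/= !ltW.
Qed.

(** Starting from one arc, reach the centers of finitely many arcs that cover K,
    gluing each of these arcs when its center is reached. *)
Lemma two_ended_exhaust (K : set X) : compact K -> K `<=` I -> I !=set0 ->
  exists M, [/\ two_ended M, M `<=` I, M !=set0 & K `<=` M].
Proof.
move=> cK KI [x0 Ix0].
have /choice[G HG] : forall x, exists g : R -> X,
    I x -> [/\ open_line g, g 0 = x & range g `<=` I].
  move=> x; have [Ix|nIx] := pselect (I x); last by exists (fun=> x).
  by have [g Hg] := line_in oI (@subset_refl _ I) Ix; exists g.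
pose J x := G x @` `[-1, 1].
have JI x : I x -> J x `<=` I.
  by move=> /HG[_ _ gI] _ [t _ <-]; apply: gI; exists t.
have J0 x : I x -> J x x.
  by move=> /HG[_ gx _]; exists 0 => //; rewrite /= in_itv/=; apply/andP;
    split; lra.
have fin (s : seq X) : (forall x, x \in s -> I x) ->
    exists M, [/\ two_ended M, M `<=` I, M !=set0 & forall x,
      x \in s -> J x `<=` M].
  elim: s => [_|x s IH sI].
    exists (J x0); split => //; last by exists x0; exact: J0.
      by apply: two_ended_line; case: (HG x0 Ix0).
    exact: JI.
  have Ix : I x by apply: sI; rewrite mem_head.
  have [|M [tM MI M0 sM]] := IH; first by move=> y ys; apply: sI;
    rewrite inE ys orbT.
  have [M' [tM' M'I MM' M'x]] := two_ended_absorb_point tM MI M0 Ix.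
  have [lg gx _] := HG x Ix.
  exists (M' `|` J x); split.
  - apply: (@two_ended_arc (G x) M' 0) => //; first by rewrite gx.
    by apply/andP; split; lra.
  - by move=> y [/M'I//|]; exact: JI.
  - by exists x; left.
  - move=> y; rewrite inE => /orP[/eqP -> z|/sM yM z /yM /MM']; first by right.
    by left.
(* finite families of points of I, directed by inclusion *)
pose F := filter_from [set s : seq X | forall x, x \in s -> I x]
  (fun s => [set s' : seq X | (forall x, x \in s' -> I x) /\ {subset s <= s'}]).
have FF : Filter F.
  apply: filter_from_filter; first by exists [::].
  move=> s s' sI s'I; exists (s ++ s').
    by move=> x; rewrite mem_cat => /orP[/sI|/s'I].
  move=> s'' [s''I ss'']; split; split=> // x xs; apply: ss'';
    by rewrite mem_cat xs ?orbT.
have [s [sI Ks]] : exists s : seq X, (forall x, x \in s -> I x) /\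
    K `<=` (fun k => exists2 x, x \in s & J x k).
  have /compact_near_coveringP cov := cK.
  have [|s0 s0I Ks0] := cov _ F (fun s k => exists2 x, x \in s & J x k) FF;
    last first.
    by exists s0; split => // k Kk; exact: (Ks0 s0 (conj s0I (fun _ =>
      id)) k Kk).
  move=> k Kk.
  have [lg gk _] := HG k (KI k Kk).
  exists (J k, [set s : seq X | k \in s]) => /=;
    last by move=> [k' s] /= [Jk' ks]; exists k.
  split.
    rewrite -{1}gk; apply: (open_line_nbhs lg).
    apply: filterS (_ : nbhs 0 (`]-1, 1[%classic : set R)).
      by move=> u /=; rewrite !in_itv/= => /andP[? ?]; rewrite !ltW.
    apply: open_nbhs_nbhs; split; first exact: interval_open.
    by rewrite /= in_itv/=; apply/andP; split; lra.
  exists [:: k]; first by move=> x; rewrite inE => /eqP ->; exact: KI.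
  by move=> s [_ ks]; apply: ks; rewrite mem_head.
have [M [tM MI M0 sM]] := fin s sI.
by exists M; split => // k /Ks[x xs]; exact: sM.
Qed.

Section ends.
Variable M : set X.
Hypotheses (tM : two_ended M) (MI : M `<=` I) (M0 : M !=set0).
Local Notation comp := (connected_component (I `\` M)).

Let oIM : open (I `\` M).
Proof. by apply: openI => //; apply: closed_openC; exact: two_ended_closed. Qed.

(** A component of the complement that stays away from the boundary of M would be
    clopen in the connected set I. *)
Lemma component_touches x : I x -> ~ M x ->
  exists2 b, (M `\` M°) b & closure (comp x) b.
Proof.
move=> Ix nMx; apply: contrapT => nb; have [m Mm] := M0.
have : comp x m.
  apply: (@connected_propagate X I (comp x) x m cI) => //.
  - move=> u Iu; have [Mu|nMu] := pselect (M u); last first.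
      have [g [lg gu gIM]] := line_in oIM (@subIsetl _ _ _) (conj Iu nMu).
      exists (range g); first by rewrite -gu; apply: open_line_nbhs => //;
        exact: filterT.
      move=> z w gz gw _ _ xz; apply: (connected_component_trans xz).
      apply: (connected_component_max gz gIM) => //.
      apply: (open_line_connected lg).
      by apply/connected_intervalP => y1 y2 _ _ y3 _.
    have [intu|nintu] := pselect (M° u).
      exists M°; first by apply: open_nbhs_nbhs; split => //;
        exact: open_interior.
      move=> z w /interior_subset Mz _ _ _ /connected_component_sub[_].
      by move=> /(_ Mz).
    have : ~ closure (comp x) u by move=> cu; apply: nb; exists u.
    move=> /existsNP[N /not_implyP[uN Nx]].
    by exists N => // z w Nz _ _ _ xz; case: Nx; exists z.
  - exact: MI.
  - by apply: connected_component_refl; split.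
by move=> /connected_component_sub[_ /(_ Mm)].
Qed.

(** In a chart at b, one side belongs to M near b. A small arc on the other side
    contains no boundary point of M, so it is contained in M or disjoint from M;
    the former would make b interior to M. *)
Lemma boundary_collar b : (M `\` M°) b ->
  exists D N, [/\ connected D, D `<=` I `\` M, nbhs b N & N `&` (I `\` M) `<=`
    D].
Proof.
move=> [Mb nMb]; have clM := two_ended_closed tM.
have [cM [b1 [b2 Mb12]] Mnd] := tM.
have [A [cA AM Ab And]] := Mnd b Mb.
have side g s : open_line g -> g 0 = b -> range g `<=` I -> 0 < s ->
    (forall t, 0 <= t < s -> M (g t)) ->
    exists D N, [/\ connected D, D `<=` I `\` M,
      nbhs b N & N `&` (I `\` M) `<=` D].
  move=> lg gb gI s0 sM; have [cg ig og] := lg.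
  have [s1 s10 Hs1] := open_line_avoid b1 lg.
  have [s2 s20 Hs2] := open_line_avoid b2 lg.
  pose r := Num.min s (Num.min s1 s2).
  have r0 : 0 < r by rewrite !lt_min s0 s10.
  have [rs rs1 rs2] : [/\ r <= s, r <= s1 & r <= s2].
    by rewrite /r !ge_min !lexx !orbT.
  have nbd t : - r < t < 0 -> M (g t) -> M° (g t).
    move=> /andP[rt t0] Mt; apply: contrapT => nMt.
    have tr : `|t| < r by rewrite ltr0_norm//; lra.
    have [/Hs1|/Hs2] : [set b1; b2] (g t) by apply: Mb12.
      by case=> [|]; lra.
    by case=> [|]; lra.
  have itvP (t : R) : (`]- r,
    0[%classic : set R) t -> - r < t < 0 by rewrite /= in_itv.
  have nM t : - r < t < 0 -> ~ M (g t).
    move=> tr Mt; apply: nMb; rewrite -gb.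
    have all u : - r < u < 0 -> M (g u).
      move=> ur.
      apply: (@connected_propagate R `]- r, 0[ (fun u => M (g u)) t u) => //.
      - exact/connected_intervalP/interval_is_interval.
      - move=> v /itvP vr; have [Mv|nMv] := pselect (M (g v)).
          exists (g @^-1` M°).
            by apply: cg; apply: open_nbhs_nbhs; split;
              [exact: open_interior|exact: nbd].
          by move=> z w _ /interior_subset.
        exists (g @^-1` (~` M)); last by [].
        by apply: cg; apply: open_nbhs_nbhs; split => //; exact: closed_openC.
    have : nbhs (g 0) (g @` `]- r, r[).
      apply: open_nbhs_nbhs; split; first exact: open_line_itv_open.
      by exists 0 => //; rewrite /= in_itv/= oppr_lt0 r0.
    apply: filterS => _ [u ub <-]; move: ub; rewrite /= in_itv/= =>
      /andP[ru ur].
    have [u0|u0] := leP 0 u; first by apply: sM; rewrite u0 (lt_le_trans ur).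
    by apply: all; rewrite ru.
  exists (g @` `]- r, 0[), (g @` `]- r, r[); split.
  - apply: (open_line_connected lg).
    exact/connected_intervalP/interval_is_interval.
  - by move=> _ [t /itvP tr <-]; split; [apply: gI; exists t|exact: nM].
  - rewrite -gb; apply: open_nbhs_nbhs; split; first exact: open_line_itv_open.
    by exists 0 => //; rewrite /= in_itv/= oppr_lt0 r0.
  - move=> _ [[t tb <-] [_ nMt]]; move: tb; rewrite /= in_itv/= => /andP[rt tr].
    exists t => //; rewrite /= in_itv/= rt/= ltNge; apply/negP => t0.
    by apply: nMt; apply: sM; rewrite t0 (lt_le_trans tr).
have [g [lg gb gI]] := line_in oI (@subset_refl _ I) (MI Mb).
have [||[s s0 sM]|[s s0 sM]] := connected_one_sided lg cA AM.
- by rewrite gb.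
- by rewrite gb.
- exact: side sM.
- apply: (side (fun t => g (- t)) s) => //.
  + exact: open_line_opp.
  + by rewrite oppr0.
  + by move=> _ [t _ <-]; apply: gI; exists (- t).
Qed.

Lemma same_end_same_component x y b : (M `\` M°) b ->
  closure (comp x) b -> closure (comp y) b -> comp x y.
Proof.
move=> /boundary_collar[D [N [cD DIM bN ND]]] xb yb.
have [z [xz Nz]] := xb N bN; have [w [yw Nw]] := yb N bN.
apply: (connected_component_trans xz).
apply: (connected_component_trans _ (connected_component_sym yw)).
apply: (connected_component_max (B := D)) => //; apply: ND; split=> //.
- exact: connected_component_sub xz.
- exact: connected_component_sub yw.
Qed.

(** By pigeonhole, two of the components of x, y and z touch the same boundary
    point, hence contain the same collar. *)
Lemma pair_in_component x y z : I x -> ~ M x -> I y -> ~ M y -> I z -> ~ M z ->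
  [\/ comp x y, comp y z | comp x z].
Proof.
move=> Ix Mx Iy My Iz Mz; have [_ [b1 [b2 Mb]] _] := tM.
have [bx Bx cx] := component_touches Ix Mx.
have [by_ By cy] := component_touches Iy My.
have [bz Bz cz] := component_touches Iz Mz.
have [ex|ex] := Mb _ Bx; have [ey|ey] := Mb _ By; have [ez|ez] := Mb _ Bz;
  rewrite ex ey ez in Bx By Bz cx cy cz;
  solve [ by apply: Or31; exact: same_end_same_component Bx cx cy
        | by apply: Or32; exact: same_end_same_component By cy cz
        | by apply: Or33; exact: same_end_same_component Bx cx cz ].
Qed.

End ends.
End two_ended.

(** * Components with three limit points, and the conclusion *)

Section interval_components.
Context {R : realType} {X : metricType R}.
Hypothesis compactX : compact [set: X].
Local Notation C := (C_ X).

(** A connected chart that meets a clopen circle is contained in it, so no point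
    of I is a limit of circles. *)
Lemma I_open : open (I_ X).
Proof.
rewrite openE => x [Ox nSx].
have [g [lg gx gO]] : exists g : R -> X, [/\ open_line g,
  g 0 = x & range g `<=` O_ X].
  by apply: O_line => //; apply: open_nbhs_nbhs; split => //; exact: O_open.
have : nbhs x (range g) by rewrite -gx; apply: open_line_nbhs => //;
  exact: filterT.
apply: filterS => y gy; split; first exact: gO.
move=> [A [cA Ay hA]]; apply: nSx; exists A; split => //.
apply: (connected_clopen _ cA (_ : (A `&` range g) !=set0)).
- by apply: (open_line_connected lg); apply/connected_intervalP => a b _ _ c _.
- by exists y.
- by rewrite -gx; exists 0.
Qed.

Lemma component_absorbs_line (V : set X) x (g : R -> X) t s : open_line g ->
  range g `<=` V -> connected_component V x (g t) -> connected_component V x (g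
    s).
Proof.
move=> lg gV xt; apply: (connected_component_trans xt).
have cg : connected (range g).
  by apply: (open_line_connected lg); apply/connected_intervalP => a b _ _ c _.
have gt : range g (g t) by exists t.
by apply: (connected_component_max gt gV cg); exists s.
Qed.

Lemma open_component (V : set X) x : open V -> V `<=` O_ X ->
  open (connected_component V x).
Proof.
move=> oV VO; rewrite openE => y xy; have Vy := connected_component_sub xy.
have [g [lg gy gV]] : exists g : R -> X, [/\ open_line g,
  g 0 = y & range g `<=` V].
  by apply: O_line; [exact: VO|exact: open_nbhs_nbhs].
rewrite -gy in xy *.
have : nbhs (g 0) (range g) by apply: open_line_nbhs => //; exact: filterT.
by apply: filterS => _ [t _ <-]; exact: component_absorbs_line xy.
Qed.

(** Components of I are closed in O, since a chart that meets such a component is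
    contained in it or in a clopen circle. The points far from C form a compact
    subset of O. *)
Lemma I_component_compact x e : 0 < e ->
  compact (connected_component (I_ X) x `&` ~` thickening C e).
Proof.
move=> e0; have cK := @thickeningC_compact _ _ compactX C e.
apply: (subclosed_compact _ cK); last exact: subIsetr.
move=> y cy; have Ky : (~` thickening C e) y.
  have clK : closed (~` thickening C e).
    exact: compact_closed (@metric_hausdorff _ X) cK.
  by apply: clK; move=> N /cy[z [[_ Kz] Nz]]; exists z.
split => //; have Oy : O_ X y.
  by apply: contrapT => Cy; apply: Ky; apply/thickeningP; exists y => //;
    rewrite mdistxx.
have [[A [cA Ay hA]]|nSy] := pselect (S_ X y).
  have [z [[xz _] Az]] := cy A (open_nbhs_nbhs (conj cA.1 Ay)).
  by have [_ []] := connected_component_sub xz; exists A.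
have [|g [lg gy gI]] := O_line Oy (N := I_ X).
  by apply: open_nbhs_nbhs; split => //; exact: I_open.
have [|z [[xz _] [t _ gt]]] := cy (range g).
  by rewrite -gy; apply: open_line_nbhs => //; exact: filterT.
by rewrite -gy; rewrite -gt in xz; exact: component_absorbs_line xz.
Qed.

(** The pair among p, q, r that shares an end may depend on e, so the displacement
    is compared with the smallest of the three distances. *)
Lemma three_end_limits (I : set X) (p q r : X) : is_component (I_ X) I ->
  p <> q -> q <> r -> p <> r ->
  closure I p -> C p -> closure I q -> C q -> closure I r -> C r ->
  tau_kC C <> tau_k X.
Proof.
move=> [x0 Ix0 IE] pq qr pr cp Cp cq Cq cr Cr.
have IO : I `<=` O_ X by rewrite IE => y /connected_component_sub[].
have oI : open I by rewrite IE; apply: open_component;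
  [exact: I_open|move=> y []].
have cI : connected I by rewrite IE; exact: component_connected.
have I0 : I !=set0 by exists x0; rewrite IE; exact: connected_component_refl.
have cptI e : 0 < e -> compact (I `&` ~` thickening C e).
  by move=> e0; rewrite IE; exact: I_component_compact.
pose D := Num.min (mdist p q) (Num.min (mdist q r) (mdist p r)).
have D0 : 0 < D by rewrite !lt_min !mdist_gt0; apply/and3P; split; exact/eqP.
have [Dpq Dqr Dpr] : [/\ D <= mdist p q, D <= mdist q r & D <= mdist p r].
  by rewrite /D !ge_min !lexx !orbT.
have D40 : 0 < D / 4 by rewrite divr_gt0.
apply: (@tau_kC_neq _ _ compactX (D / 2)); first by rewrite divr_gt0.
move=> e e0.
have [M [tM MI M0 KM]] := two_ended_exhaust oI cI IO (cptI e e0)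
  (@subIsetl _ _ _) I0.
have IMe : I `\` M `<=` thickening C e.
  by move=> y [Iy nMy]; apply: contrapT => ye; apply: nMy; apply: KM; split.
have oIM : open (I `\` M).
  by apply: openI => //; apply: closed_openC; exact: two_ended_closed.
have near_end w : closure I w -> C w -> exists x, [/\ I x,
  ~ M x & mdist w x < D / 4].
  move=> cw Cw; have wM : nbhs w (~` M).
    apply: open_nbhs_nbhs; split; first by apply: closed_openC;
      exact: two_ended_closed.
    by move=> /MI/IO; exact: Cw.
  have [x [Ix [Mx wx]]] := cw _ (filterI wM (mdist_near w D40)).
  by exists x.
have push w z x y : D <= mdist w z -> mdist w x < D / 4 -> mdist z y < D / 4 ->
    I x -> ~ M x -> connected_component (I `\` M) x y ->
    exists2 h : homeo X, B_tau_kC C e h & exists x, D / 2 <= mdist x (h x).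
  move=> wz wx zy Ix Mx xy.
  have [||||||h Bh hx] := @move_in_thickening _ _ compactX
      (connected_component (I `\` M) x) e x y e0.
  - exact: component_connected.
  - by apply: open_component => // u [/IO].
  - by move=> u /connected_component_sub[/IO].
  - by move=> u /connected_component_sub /IMe.
  - by apply: connected_component_refl; split.
  - by [].
  exists h => //; exists x; rewrite hx.
  have := metric_triangle w x z; have := metric_triangle x y z.
  by rewrite (metric_sym y z); lra.
have [x [Ix Mx px]] := near_end p cp Cp.
have [y [Iy My qy]] := near_end q cq Cq.
have [z [Iz Mz rz]] := near_end r cr Cr.
have [xy|yz|xz] := pair_in_component oI cI IO tM MI M0 Ix Mx Iy My Iz Mz.
- exact: push Dpq px qy Ix Mx xy.
- exact: push Dqr qy rz Iy My yz.
- exact: push Dpr px rz Ix Mx xz.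
Qed.

End interval_components.

Lemma card_le_II_inj (T : Type) (n : nat) (A : set T) : `I_n.+1 #<= A ->
  exists f : nat -> T, (forall i, A (f i)) /\
    forall i j, (i <= n)%N -> (j <= n)%N -> f i = f j -> i = j.
Proof.
move=> /card_leP[F].
(* truncating the index at n gives a total function without a default value *)
have le_n i : (minn i n \in `I_n.+1) by apply/mem_set; rewrite /= ltnS geq_minr.
exists (fun i => set_val (F (SigSub (le_n i)))); split=> [i|i j lein lejn].
  exact: set_valP.
move=> /val_inj FE.
have e : minn i n = minn j n :=
  congr1 set_val ('inj_F (mem_set I) (mem_set I) FE).
by move: e; rewrite (minn_idPl lein) (minn_idPl lejn).
Qed.

Theorem proposition9 (R : realType) (X : metricType R)
  (compactX : compact [set: X]) (denseO : dense (O_ X)) :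
  (`I_2 #<= closure (S_ X) `&` C_ X \/
   exists2 I : set X, is_component (I_ X) I & `I_3 #<= closure I `&` C_ X) ->
  tau_kC (C_ X) <> tau_k X /\ ~ minimal_group_topology (tau_k X).
Proof.
move=> H.
have neq : tau_kC (C_ X) <> tau_k X.
  case: H => [/card_le_II_inj[f [fA finj]]|[I cI /card_le_II_inj[f [fA finj]]]].
    have [S0 C0] := fA 0%N; have [S1 C1] := fA 1%N.
    by apply: (two_circle_limits compactX _ S0 C0 S1 C1) => /finj e; have :=
      e isT isT.
  have [I0 C0] := fA 0%N; have [I1 C1] := fA 1%N; have [I2 C2] := fA 2%N.
  by apply: (three_end_limits compactX cI _ _ _ I0 C0 I1 C1 I2 C2) => /finj e;
    have := e isT isT.
split => //; apply; exists (tau_kC (C_ X)); split.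
- exact: (tau_kC_group_topology compactX (@homeo_C R X)).
- apply: tau_kC_hausdorff; first exact: C_closed.
  by rewrite /C_ setCK.
- rewrite properEneq; split; first exact/eqP.
  exact: (tau_kC_sub_tau_k compactX (@homeo_C R X)).
Qed.
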